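(* Let $p\ge2$, $d\ge1$, $r\ge d+1$ be integers, $\mathcal{P}=\{1,\dots,p\}$, $v\ge0$, and let $\bm{A}\in\mathbb{R}^{r\times d}$ be a fixed matrix with $\mathbf{1}_r^\top\bm{A}=\mathbf{0}_d^\top$ and $\bm{A}^\top\bm{A}=\bm{I}_d$. For $i\in\mathcal{P}$ let $\bm{O}_i\in\mathcal{O}(d)$, $\Psi_i\in\mathbb{R}^d$, and $$\bm{B}_i=\bm{A}\bm{O}_i+\mathbf{1}_r\Psi_i^\top+v\bm{W}_i,$$ where each $\bm{W}_i\in\mathbb{R}^{r\times d}$ has i.i.d. $\mathcal{N}(0,1)$ entries, the matrices $\bm{W}_i$, $i\in\mathcal{P}$, are mutually independent, and the collection $\{\bm{W}_i\}_{i\in\mathcal P}$ is independent of the parameters $\{(\bm{O}_i,\Psi_i)\}_{i\in\mathcal P}$. Suppose that the estimated rotations $\widehat{\bm{R}}_1,\dots,\widehat{\bm{R}}_p\in\mathcal{O}(d)$ are computed exclusively from the centered anchor representations $\overline{\bm{B}}_i=(\bm{I}_r-\frac1r\mathbf{1}_r\mathbf{1}_r^\top)\bm{B}_i$, $i\in\mathcal{P}$. Let $$\boldsymbol{\eta}_i=\frac{v}{r}\bm{W}_i^\top\mathbf{1}_r .$$ Then $\boldsymbol{\eta}_i\sim\mathcal{N}\!\left(\mathbf{0}_d,\frac{v^2}{r}\bm{I}_d\right)$ for every $i\in\mathcal{P}$, and the collection $\{\boldsymbol{\eta}_i\}_{i\in\mathcal{P}}$ is independent of the estimated rotations. Consequently,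 conditionally on the estimated rotations, the vectors $\widehat{\bm{R}}_i^\top\boldsymbol{\eta}_i$, $i\in\mathcal{P}$, are independent and each follows $\mathcal{N}\!\left(\mathbf{0}_d,\frac{v^2}{r}\bm{I}_d\right)$. For every fixed pair $i\ne j$, $$\widehat{\bm{R}}_i^\top\boldsymbol{\eta}_i-\widehat{\bm{R}}_j^\top\boldsymbol{\eta}_j\sim\mathcal{N}\!\left(\mathbf{0}_d,\frac{2v^2}{r}\bm{I}_d\right),\qquad \mathbb{E}\!\left[\left\|\widehat{\bm{R}}_i^\top\boldsymbol{\eta}_i-\widehat{\bm{R}}_j^\top\boldsymbol{\eta}_j\right\|_2^2\right]=\frac{2dv^2}{r}.$$ Moreover, for every $0<\zeta<1$, with probability at least $1-\zeta$, $$\left\|\widehat{\bm{R}}_i^\top\boldsymbol{\eta}_i-\widehat{\bm{R}}_j^\top\boldsymbol{\eta}_j\right\|_2\le\frac{\sqrt2\,v}{\sqrt r}\left(\sqrt d+\sqrt{2\log(1/\zeta)}\right).$$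
   Context: $\mathcal{O}(d)$ is the group of real orthogonal $d\times d$ matrices and $\mathbf{1}_r\in\mathbb{R}^r$ the all-ones column vector. ''Computed exclusively from the centered anchor representations'' means that $(\widehat{\bm{R}}_1,\dots,\widehat{\bm{R}}_p)$ is a measurable function of $(\overline{\bm{B}}_1,\dots,\overline{\bm{B}}_p)$. For $v=0$ the Gaussian laws are understood as point masses at $0$. *)

(* Defs.v *)
From HB Require Import structures.
From mathcomp Require Import all_boot all_order all_algebra.
From mathcomp Require Import all_classical all_reals all_analysis.
From mathcomp Require Import measurable_realfun.
Set Implicit Arguments.
Unset Strict Implicit.
Unset Printing Implicit Defensive.
Import Order.TTheory GRing.Theory Num.Theory.
Import numFieldNormedType.Exports.
Local Open Scope classical_set_scope.
Local Open Scope ring_scope.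

(* Matrices carry the sigma-algebra generated by their entries, i.e. the Borel
   sigma-algebra of R^(m x n). *)
Definition measure_matrix_display : measure_display -> measure_display.
Proof. exact. Qed.

Section measurable_matrix.
Context {R : realType} (m n : nat).

Definition g_sigma_entries : set (set 'M[R]_(m, n)) :=
  <<s \bigcup_(ij in [set: 'I_m * 'I_n])
        preimage_set_system setT (fun M : 'M[R]_(m, n) => M ij.1 ij.2)
          (@measurable _ R) >>.

Let matrix_set0 : g_sigma_entries set0.
Proof. exact: sigma_algebra0. Qed.

Let matrix_setC A : g_sigma_entries A -> g_sigma_entries (~` A).
Proof. exact: sigma_algebraC. Qed.

Let matrix_bigcup (F : (set 'M[R]_(m, n))^nat) :
  (forall i, g_sigma_entries (F i)) -> g_sigma_entries (\bigcup_i F i).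
Proof. exact: sigma_algebra_bigcup. Qed.

HB.instance Definition _ := @isMeasurable.Build
  (measure_matrix_display default_measure_display)
  'M[R]_(m, n) g_sigma_entries matrix_set0 matrix_setC matrix_bigcup.

End measurable_matrix.

Section probability_notions.
Context {d : measure_display} {T : measurableType d} {R : realType}.
Variable P : probability T R.

Definition joint {V : Type} {p : nat} (X : 'I_p -> T -> V) : T -> p.-tuple V :=
  fun w => [tuple X i w | i < p].

Definition independent {d1 d2 : measure_display} {V1 : measurableType d1}
    {V2 : measurableType d2} (X : T -> V1) (Y : T -> V2) : Prop :=
  forall (E : set V1) (F : set V2), measurable E -> measurable F ->
    P (X @^-1` E `&` Y @^-1` F) = (P (X @^-1` E) * P (Y @^-1` F))%E.

Definition mutually_independent {I : finType} {d' : measure_display}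
    {V : measurableType d'} (X : I -> T -> V) : Prop :=
  forall (J : {set I}) (E : I -> set V), (forall i, measurable (E i)) ->
    P (\bigcap_(i in [set` J]) X i @^-1` E i) =
    (\prod_(i in J) P (X i @^-1` E i))%E.

(* h (Y w) is a version of the conditional probability of A given Y. *)
Definition is_cond_prob {d' : measure_display} {S : measurableType d'}
    (Y : T -> S) (A : set T) (h : S -> \bar R) : Prop :=
  [/\ measurable_fun setT h,
      P.-integrable setT (h \o Y) &
      forall C : set S, measurable C ->
        P (A `&` Y @^-1` C) = (\int[P]_(w in Y @^-1` C) h (Y w))%E].

(* Conditional independence given Y of a finite family; subfamilies are
   covered by taking E i = setT. *)
Definition cond_mutually_independent {I : finType} {d1 d2 : measure_display}
    {V : measurableType d1} {S : measurableType d2}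
    (X : I -> T -> V) (Y : T -> S) : Prop :=
  forall (E : I -> set V) (h : I -> S -> \bar R),
    (forall i, measurable (E i)) ->
    (forall i, is_cond_prob Y (X i @^-1` E i) (h i)) ->
    is_cond_prob Y (\bigcap_i X i @^-1` E i) (fun y => \prod_i h i y)%E.

Definition is_cond_law {d1 d2 : measure_display}
    {V : measurableType d1} {S : measurableType d2}
    (X : T -> V) (Y : T -> S) (k : R.-pker S ~> V) : Prop :=
  forall E : set V, measurable E ->
    is_cond_prob Y (X @^-1` E) (fun y => k y E).

End probability_notions.

(* X is a measurable function of Y. *)
Definition computed_from {d1 d2 : measure_display} {T : Type}
    {V : measurableType d1} {S : measurableType d2}
    (X : T -> V) (Y : T -> S) : Prop :=
  exists2 g : S -> V, measurable_fun setT g & forall w, X w = g (Y w).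

Section gaussian.
Context {R : realType}.

(* N(m, s2) on the line, parametrized by the variance s2 >= 0.  The case s2 = 0
   is separate because normal_prob m 0 is not the point mass at m. *)
Definition normal_law (m s2 : R) (E : set R) : \bar R :=
  if s2 == 0 then \d_m E else normal_prob m (Num.sqrt s2) E.

(* mu = N(m, Sigma) on R^n: every linear functional u^T x is normal with mean
   u^T m and variance u^T Sigma u (Sigma possibly degenerate). *)
Definition gaussian_law {n : nat} (mu : set 'cV[R]_n -> \bar R)
    (m : 'cV[R]_n) (Sigma : 'M[R]_n) : Prop :=
  forall (u : 'cV[R]_n) (E : set R), measurable E ->
    mu [set x | E ((u^T *m x) 0 0)] =
    normal_law ((u^T *m m) 0 0) ((u^T *m Sigma *m u) 0 0) E.

Context {d : measure_display} {T : measurableType d} (P : probability T R).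

Definition gaussian_vector {n : nat} (X : T -> 'cV[R]_n)
    (m : 'cV[R]_n) (Sigma : 'M[R]_n) : Prop :=
  measurable_fun setT X /\ gaussian_law (pushforward P X) m Sigma.

Definition cond_gaussian_vector {n : nat} {d' : measure_display}
    {S : measurableType d'} (X : T -> 'cV[R]_n) (Y : T -> S)
    (m : 'cV[R]_n) (Sigma : 'M[R]_n) : Prop :=
  exists2 k : R.-pker S ~> 'cV[R]_n,
    is_cond_law P X Y k & forall y, gaussian_law (k y) m Sigma.

End gaussian.

Section model.
Context {R : realType}.

Definition orthogonal_mx {n : nat} (M : 'M[R]_n) : Prop := M^T *m M = 1%:M.

Definition ones (r : nat) : 'cV[R]_r := const_mx 1.

(* The library norm on matrices is the sup norm. *)
Definition norm2 {n : nat} (x : 'cV[R]_n) : R :=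
  Num.sqrt (\sum_i x i 0 ^+ 2).

Definition anchor {r n : nat} (A : 'M[R]_(r, n)) (v : R)
    (O : 'M[R]_n) (Psi : 'cV[R]_n) (W : 'M[R]_(r, n)) : 'M[R]_(r, n) :=
  A *m O + ones r *m Psi^T + v *: W.

Definition centered {r n : nat} (B : 'M[R]_(r, n)) : 'M[R]_(r, n) :=
  (1%:M - r%:R^-1 *: (ones r *m (ones r)^T)) *m B.

Definition translation_noise {r n : nat} (v : R) (W : 'M[R]_(r, n)) : 'cV[R]_n :=
  (v / r%:R) *: (W^T *m ones r).

End model.

(* Main.v *)
(* With C the centering matrix, C B_i = A O_i + v C W_i, so the estimated
   rotations are a function of the (O_i, Psi_i) and of the deviations C W_i,
   whereas eta_i is a multiple of the column means of W_i.  Means and deviations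
   are inner products of the standard normal family of all entries of the W_i
   with mutually orthogonal families of vectors.  An orthonormal family can be
   moved onto coordinate vectors by plane rotations and sign flips, which
   preserve the standard normal law (in the plane, by two affine substitutions in
   the Lebesgue integral); hence inner products with orthonormal vectors are again
   standard normal, and independent of inner products with vectors orthogonal to
   them.  So eta is independent of the rotations, and integrating over the value
   of the rotations (Fubini), the rotated noise has the law of eta and is still
   independent of them.  The tail bound is Chernoff's inequality for the
   chi-square law. *)

Require Import Defs.
From HB Require Import structures.
From mathcomp Require Import all_boot all_order all_algebra.
From mathcomp Require Import all_classical all_reals all_analysis.
From mathcomp Require Import measurable_realfun ring lra.
Set Implicit Arguments.
Unset Strict Implicit.
Unset Printing Implicit Defensive.
Import Order.TTheory GRing.Theory Num.Theory.
Import numFieldNormedType.Exports.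
Local Open Scope classical_set_scope.
Local Open Scope ring_scope.

(** * The normal law on the line *)

(** Only the plane case needs a change of variables. A law on a finite product is fixed by its
    values on boxes, so a rotation in two coordinates can be treated with all the other coordinates
    frozen in an event. The noise is studied through normalised column means, which form a standard
    normal family whatever [v] is; [v] enters only as the coefficient [v / sqrt r]. The case [v = 0]
    therefore shows up just where a coefficient vector may vanish: in the law of one linear
    functional and in the tail bound. The estimated rotations are random, so rotating the noise by
    them is not a fixed isometry. What rescues the argument is that the rotated noise has the same
    law for every frozen value of the rotations. Testing the rotated noise and the rotations
    together, by one event for each, then gives the law and the independence in a single
    computation. The second moment comes from the exponential moments already required for the tail
    bound, through [1 + y <= expR y]. *)

Section gaussian_line.
Context {R : realType}.
Local Notation mu := (@lebesgue_measure R).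
Local Open Scope ereal_scope.

(** Multiplied by [a], the image of Lebesgue measure under the affine map gives every interval []x,
    y]] its length, and this property characterises Lebesgue measure. *)
Lemma lebesgue_measure_affine (a b : R) (A : set R) : (0 < a)%R ->
  measurable A ->
  mu ((fun x => a * x + b)%R @^-1` A) = a^-1%:E * mu A.
Proof.
move=> a0 mA; have a_ge0 : (0 <= a)%R := ltW a0.
pose h := (fun x => a * x + b)%R : measurableTypeR R -> measurableTypeR R.
have mh : measurable_fun setT h.
  by apply: measurable_funD => //; exact: measurable_funM.
pose nu := mscale (NngNum a_ge0) (pushforward mu h).
have -> : mu A = nu mh A.
  apply: lebesgue_measure_unique => //= _ [[x y]] _ <-.
  change (mu `]x, y]%classic = a%:E * mu (h @^-1` `]x, y]%classic)).
  have -> : (h @^-1` `]x, y] = `](x - b) / a, (y - b) / a]%classic)%R.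
    apply/seteqP; split => t; rewrite /h /= !in_itv/= ltr_pdivrMr// ler_pdivlMr//;
    by rewrite ltrBlDr lerBrDr (mulrC t).
  rewrite !lebesgue_measure_itv/= !lte_fin ltr_pM2r ?invr_gt0// ltrD2r.
  case: ifP => _; last by rewrite mule0.
  rewrite -!EFinD -EFinM; congr EFin.
  by field; rewrite gt_eqF.
by rewrite /nu /mscale /pushforward /= muleA -EFinM mulVf ?gt_eqF// mul1e.
Qed.

Lemma ge0_integral_affine (a b : R) (f : R -> \bar R) : (0 < a)%R ->
  measurable_fun setT f -> (forall x, 0 <= f x) ->
  \int[mu]_x f (a * x + b)%R = a^-1%:E * \int[mu]_x f x.
Proof.
move=> a0 mf f0; have a_ge0 : (0 <= a^-1)%R by rewrite invr_ge0 ltW.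
pose h := (fun x => a * x + b)%R : measurableTypeR R -> measurableTypeR R.
have mh : measurable_fun setT h.
  by apply: measurable_funD => //; exact: measurable_funM.
rewrite -[RHS](ge0_integral_mscale mu measurableT (NngNum a_ge0))//.
rewrite -[LHS](@ge0_integral_pushforward _ _ _ _ _ h mh mu setT f)//.
by apply: eq_measure_integral => A mA _; exact: lebesgue_measure_affine.
Qed.

(** Change of variables holds with the Radon-Nikodym derivative of the normal law; that derivative
    agrees almost everywhere with the density because both have the same integral over every
    measurable set. *)
Lemma ge0_integral_normal_prob (m s : R) (f : R -> \bar R) :
  measurable_fun setT f -> (forall x, 0 <= f x) ->
  \int[normal_prob m s]_x f x = \int[mu]_x (f x * (normal_pdf m s x)%:E).
Proof.
move=> mf f0; have dom := @normal_prob_dominates R m s.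
rewrite -(Radon_Nikodym_SigmaFinite.change_of_variables dom)//.
have mpdf : measurable_fun setT (fun x => (normal_pdf m s x)%:E).
  by apply/measurable_EFinP; exact: measurable_normal_pdf.
have mRN := measurable_int _ (Radon_Nikodym_SigmaFinite.f_integrable dom).
apply: ae_eq_integral => //; [exact: emeasurable_funM..|].
apply: ae_eqe_mul2l; apply: integral_ae_eq => //.
  exact: Radon_Nikodym_SigmaFinite.f_integrable.
by move=> E _ mE; rewrite -Radon_Nikodym_SigmaFinite.f_integral.
Qed.

Lemma normal_pdf0E (s x : R) : s != 0%R ->
  normal_pdf 0 s x = (normal_peak s * expR (- x ^+ 2 / (s ^+ 2 *+ 2)))%R.
Proof. by move=> s0; rewrite normal_pdfE// /normal_fun subr0. Qed.

Lemma normal_peakE (s : R) : (0 < s)%R ->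
  normal_peak s = (s^-1 * normal_peak 1)%R.
Proof.
move=> s0; rewrite /normal_peak expr1n mul1r -mulrnAr sqrtrM ?sqr_ge0//.
by rewrite sqrtr_sqr gtr0_norm// invfM.
Qed.

Lemma normal_prob_scale (s : R) (E : set R) : (0 < s)%R -> measurable E ->
  normal_prob 0 1 ((fun x => s * x)%R @^-1` E) = normal_prob 0 s E.
Proof.
move=> s0 mE; rewrite /normal_prob [LHS]integral_mkcond [RHS]integral_mkcond/=.
have s0' : s != 0%R by rewrite gt_eqF.
have mg : measurable_fun setT (patch (fun=> 0) E (fun x => (normal_pdf 0 s x)%:E)).
  apply/(measurable_restrictT _ mE)/measurable_funTS/measurable_EFinP.
  exact: measurable_normal_pdf.
(* The added 0 gives the argument the affine form of [ge0_integral_affine]. *)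
transitivity (\int[mu]_x (s%:E *
    (patch (fun=> 0) E (fun x => (normal_pdf 0 s x)%:E)) (s * x + 0)%R)).
  apply: eq_integral => x _; rewrite addr0 !patchE.
  have -> : (x \in (fun x => s * x)%R @^-1` E) = ((s * x)%R \in E).
    by apply/idP/idP; rewrite !inE.
  case: ifP => _; last by rewrite mule0.
  rewrite -EFinM !normal_pdf0E ?oner_eq0// (normal_peakE s0); congr EFin.
  rewrite expr1n !mulrA mulfV// mul1r; congr (_ * expR _)%R.
  by rewrite -mulr_natl -[in RHS]mulr_natl; field.
rewrite ge0_integralZl//; last first.
- by rewrite lee_fin ltW.
- by move=> x _; rewrite patchE; case: ifP => //; rewrite lee_fin normal_pdf_ge0.
- apply: (@measurableT_comp _ _ _ _ _ _ _ _ (fun x => s * x + 0)%R) => //.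
  by apply: measurable_funD => //; exact: measurable_funM.
rewrite ge0_integral_affine//; last first.
  by move=> x; rewrite patchE; case: ifP => //; rewrite lee_fin normal_pdf_ge0.
by rewrite muleA -EFinM mulfV// mul1e.
Qed.

(** Reflections are treated apart since the affine substitution above has a positive slope. *)
Lemma normal_probN (E : set R) : measurable E ->
  normal_prob 0 1 (-%R @^-1` E) = normal_prob 0 1 E.
Proof.
move=> mE; rewrite /normal_prob [LHS]integral_mkcond [RHS]integral_mkcond/=.
have mg : measurable_fun setT (patch (fun=> 0) E (fun x => (normal_pdf 0 1 x)%:E)).
  apply/(measurable_restrictT _ mE)/measurable_funTS/measurable_EFinP.
  exact: measurable_normal_pdf.
transitivity (\int[mu]_x
    (patch (fun=> 0) E (fun x => (normal_pdf 0 1 x)%:E)) (- x)%R).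
  apply: eq_integral => x _; rewrite !patchE.
  have -> : (x \in -%R @^-1` E) = ((- x)%R \in E) by apply/idP/idP; rewrite !inE.
  by rewrite !normal_pdf0E ?oner_eq0// sqrrN.
rewrite -[LHS](@ge0_integral_pushforward _ _ _ _ _
  (-%R : measurableTypeR R -> measurableTypeR R) _ mu setT
  (patch (fun=> 0) E (fun x => (normal_pdf 0 1 x)%:E)))//.
  by apply: eq_measure_integral => A mA _; exact: lebesgue_measureN.
by move=> x _; rewrite patchE; case: ifP => //; rewrite lee_fin normal_pdf_ge0.
Qed.

(** Multiplying the standard density by this exponential gives [s] times the density of standard
    deviation [s]. Parametrising the exponent by [s] makes the moment equal to [s] itself; the
    exponent is positive for [s > 1] and negative for [s < 1]. *)
Lemma integral_normal_exp_sqr (s : R) : (0 < s)%R ->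
  \int[normal_prob 0 1]_x (expR ((1 - s ^- 2) / 2 * x ^+ 2))%:E = s%:E.
Proof.
move=> s0; have s0' : s != 0%R by rewrite gt_eqF.
have mexp : measurable_fun setT
    (fun x : R => (expR ((1 - s ^- 2) / 2 * x ^+ 2))%:E).
  apply/measurable_EFinP/measurableT_comp => //.
  by apply: measurable_funM => //; exact: measurable_funX.
rewrite ge0_integral_normal_prob//.
transitivity (\int[mu]_x (s%:E * (normal_pdf 0 s x)%:E)).
  apply: eq_integral => x _; rewrite -!EFinM; congr EFin.
  rewrite !normal_pdf0E ?oner_eq0// (normal_peakE s0).
  rewrite mulrCA -expRD !mulrA mulfV// mul1r; congr (_ * expR _)%R.
  by rewrite -mulr_natl -[in RHS]mulr_natl; field.
rewrite ge0_integralZl//.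
- by rewrite integral_normal_pdf mule1.
- by apply/measurable_EFinP; exact: measurable_normal_pdf.
- by move=> x _; rewrite lee_fin normal_pdf_ge0.
- by rewrite lee_fin ltW.
Qed.

(** Integrating [1 + y <= expR y] with [y] a small multiple of [x ^+ 2], positive or negative,
    squeezes the second moment between bounds that both tend to 1 as [s] tends to 1. *)
Lemma integral_normal_sqr : \int[normal_prob 0 1]_x ((x : R) ^+ 2)%:E = 1.
Proof.
set I := LHS.
have msqr : measurable_fun setT (fun x : R => (x ^+ 2)%:E).
  by apply/measurable_EFinP; exact: measurable_funX.
have I0 : 0 <= I by apply: integral_ge0 => x _; rewrite lee_fin sqr_ge0.
have mexp l : measurable_fun setT (fun x : R => (expR (l * x ^+ 2))%:E).
  apply/measurable_EFinP/measurableT_comp => //.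
  by apply: measurable_funM => //; exact: measurable_funX.
have up (s : R) : (1 < s)%R -> ((1 - s ^- 2) / 2)%:E * I + 1 <= s%:E.
  move=> s1; have s0 : (0 < s)%R by lra.
  have l0 : (0 <= (1 - s ^- 2) / 2)%R.
    rewrite divr_ge0// subr_ge0 invf_le1 ?exprn_gt0//.
    by rewrite expr_ge1// ltW.
  rewrite -(integral_normal_exp_sqr s0) -ge0_integralZl//; last first.
    by move=> x _; rewrite lee_fin sqr_ge0.
  rewrite -(@probability_setT _ _ _ (@normal_prob R 0 1)).
  rewrite -[X in _ + X]mul1e -integral_cst// -ge0_integralD//; last first.
  - by apply: emeasurable_funM.
  - by move=> x _; rewrite -EFinM lee_fin mulr_ge0// sqr_ge0.
  apply: ge0_le_integral => //.
  - by move=> x _; rewrite -EFinM -EFinD lee_fin addr_ge0// mulr_ge0// sqr_ge0.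
  - by apply: emeasurable_funD => //; exact: emeasurable_funM.
  - exact: mexp.
  - by move=> x _; rewrite -EFinM -EFinD lee_fin addrC expR_ge1Dx.
have down (s : R) : (0 < s < 1)%R -> 1 <= s%:E + ((s ^- 2 - 1) / 2)%:E * I.
  move=> /andP[s0 s1].
  have l0 : (0 <= (s ^- 2 - 1) / 2)%R.
    rewrite divr_ge0// subr_ge0 invf_ge1 ?exprn_gt0//.
    by rewrite expr_le1// ltW.
  rewrite -(integral_normal_exp_sqr s0) -ge0_integralZl//; last first.
    by move=> x _; rewrite lee_fin sqr_ge0.
  rewrite -(@probability_setT _ _ _ (@normal_prob R 0 1)).
  rewrite -[X in X <= _]mul1e -integral_cst// -ge0_integralD//; last first.
  - by apply: emeasurable_funM.
  - by move=> x _; rewrite -EFinM lee_fin mulr_ge0// sqr_ge0.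
  - exact: mexp.
  apply: ge0_le_integral => //.
  - by apply: emeasurable_funD; [exact: mexp|exact: emeasurable_funM].
  - move=> x _; rewrite -EFinM -EFinD lee_fin /=.
    have := expR_ge1Dx ((1 - s ^- 2) / 2 * x ^+ 2); lra.
(* At [s = 2] the coefficient of [I] in [up] is 3/8, so an infinite [I] would contradict the finite
   right-hand side. *)
have [m Im] : exists m, I = m%:E.
  move: I0 (up 2%R ltac:(lra)); clear up down.
  case: I => [m _ _|_|//]; first by exists m.
  rewrite gt0_muley; last by rewrite lte_fin; lra.
  by rewrite addye.
move: up down I0; rewrite Im lee_fin => up down m0.
congr EFin; apply/eqP; rewrite eq_le; apply/andP; split.
(* With [s = 1 + t], [up] gives [I <= 2 (1 + t)^2 / (2 + t)], which is at most [1 + 4 t] for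
   [t <= 1]. *)
- apply/ler_addgt0Pr => e e0; pose t := Num.min 1%R (e / 4)%R.
  have t0 : (0 < t)%R by rewrite /t lt_min ltr01 divr_gt0.
  have t1 : (t <= 1)%R by rewrite /t ge_min lexx.
  have te : (t <= e / 4)%R by rewrite /t ge_min lexx orbT.
  have := up (1 + t)%R ltac:(lra); rewrite -EFinM -EFinD lee_fin.
  have -> : ((1 - (1 + t) ^- 2) / 2 = t * (2 + t) / 2 / (1 + t) ^+ 2)%R.
    by field; rewrite gt_eqF//; lra.
  rewrite -lerBrDr mulrAC ler_pdivrMr; last by rewrite exprn_gt0//; lra.
  nra.
(* With [s = 1 - t], [down] gives [I >= 2 (1 - t)^2 / (2 - t)], which is at least [1 - 4 t] for
   [t <= 1/2]. *)
- apply/ler_addgt0Pr => e e0; pose t := Num.min (2^-1)%R (e / 4)%R.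
  have t0 : (0 < t)%R by rewrite /t lt_min invr_gt0 ltr0n divr_gt0.
  have t1 : (t <= 2^-1)%R by rewrite /t ge_min lexx.
  have te : (t <= e / 4)%R by rewrite /t ge_min lexx orbT.
  have := down (1 - t)%R ltac:(lra); rewrite -EFinM -EFinD lee_fin.
  have -> : (((1 - t) ^- 2 - 1) / 2 = t * (2 - t) / 2 / (1 - t) ^+ 2)%R.
    by field; rewrite gt_eqF//; lra.
  rewrite -lerBlDl mulrAC ler_pdivlMr; last by rewrite exprn_gt0//; lra.
  nra.
Qed.

End gaussian_line.

(** * Borel sets of finite products and independence *)

Definition measure_ffun_display : measure_display -> measure_display.
Proof. exact. Qed.

Section measurable_ffun.
Context {R : realType} (I : finType).
Local Notation V := {ffun I -> R}.

HB.instance Definition _ := isPointed.Build V 0.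

(** Arbitrary finite index types let products such as ['I_p * ('I_r * 'I_d)] and sums such as
    [B + C] index the families directly. *)
Definition g_sigma_coordinates : set (set V) :=
  <<s \bigcup_(i in [set: I])
        preimage_set_system setT (fun x : V => x i) (@measurable _ R) >>.

Let ffun_set0 : g_sigma_coordinates set0.
Proof. exact: sigma_algebra0. Qed.

Let ffun_setC A : g_sigma_coordinates A -> g_sigma_coordinates (~` A).
Proof. exact: sigma_algebraC. Qed.

Let ffun_bigcup (F : (set V)^nat) :
  (forall i, g_sigma_coordinates (F i)) -> g_sigma_coordinates (\bigcup_i F i).
Proof. exact: sigma_algebra_bigcup. Qed.

HB.instance Definition _ := @isMeasurable.Build
  (measure_ffun_display default_measure_display)
  V g_sigma_coordinates ffun_set0 ffun_setC ffun_bigcup.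

End measurable_ffun.

Lemma preimage_measurable d1 d2 (T : measurableType d1) (V : measurableType d2)
    (X : T -> V) (E : set V) :
  measurable_fun setT X -> measurable E -> measurable (X @^-1` E).
Proof. by move=> mX mE; rewrite -[X in measurable X]setTI; exact: mX. Qed.

Section generated_sigma_algebra.
Context {R : realType} {d : measure_display} {T : measurableType d}.

(** The abstract family [p] of generating maps serves both coordinates of finite functions and
    entries of matrices. *)
Lemma measurable_fun_generated (d' : measure_display) (V : measurableType d')
    (J : Type) (p : J -> V -> R) (f : T -> V) :
  @measurable _ V = <<s \bigcup_(j in [set: J])
    preimage_set_system setT (p j) (@measurable _ R) >> ->
  (forall j, measurable_fun setT (p j \o f)) -> measurable_fun setT f.
Proof.
move=> mV mf; apply: (measurability _ mV) => _ [_ [j _ [C mC <-]] <-].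
by have := preimage_measurable (mf j) mC; rewrite !setTI.
Qed.

Lemma measurable_fun_coordinate (d' : measure_display) (V : measurableType d')
    (J : Type) (p : J -> V -> R) (j : J) :
  @measurable _ V = <<s \bigcup_(j in [set: J])
    preimage_set_system setT (p j) (@measurable _ R) >> ->
  measurable_fun setT (p j).
Proof.
move=> mV _ C mC; rewrite mV; apply: sub_sigma_algebra.
by exists j => //; exists C.
Qed.

Lemma measurable_fun_ffunP (I : finType) (f : T -> {ffun I -> R}) :
  (forall i, measurable_fun setT (fun w => f w i)) -> measurable_fun setT f.
Proof.
exact: (@measurable_fun_generated _ _ I (fun i (x : {ffun I -> R}) => x i)).
Qed.

Lemma measurable_fun_matrixP (m n : nat) (f : T -> 'M[R]_(m, n)) :
  (forall i j, measurable_fun setT (fun w => f w i j)) -> measurable_fun setT f.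
Proof.
move=> mf; apply: (@measurable_fun_generated _ _ ('I_m * 'I_n)
  (fun ij (M : 'M[R]_(m, n)) => M ij.1 ij.2)) => // ij; exact: mf.
Qed.

End generated_sigma_algebra.

Lemma measurable_coordinate {R : realType} (I : finType) (i : I) :
  measurable_fun setT (fun x : {ffun I -> R} => x i).
Proof.
exact: (@measurable_fun_coordinate _ _ _ I (fun i (x : {ffun I -> R}) => x i)).
Qed.

Lemma measurable_entry {R : realType} (m n : nat) (i : 'I_m) (j : 'I_n) :
  measurable_fun setT (fun M : 'M[R]_(m, n) => M i j).
Proof.
exact: (@measurable_fun_coordinate _ _ _ ('I_m * 'I_n)%type
  (fun ij (M : 'M[R]_(m, n)) => M ij.1 ij.2) (i, j)).
Qed.

Section boxes.
Context {R : realType} (I : finType).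
Local Notation V := {ffun I -> R}.

Definition box (E : I -> set R) : set V := [set x | forall i, E i (x i)].

Definition boxes : set (set V) :=
  [set B | exists2 E, (forall i, measurable (E i)) & B = box E].

Lemma measurable_box (E : I -> set R) :
  (forall i, measurable (E i)) -> measurable (box E).
Proof.
move=> mE; rewrite (_ : box E = \bigcap_(i in [set: I])
  (setT `&` (fun x : V => x i) @^-1` E i)); last first.
  by apply/seteqP; split => x Ex i //=; have [] := Ex i.
apply: fin_bigcap_measurable; first exact: finite_finset.
by move=> i _; exact: measurable_coordinate.
Qed.

Lemma measurable_boxesE : @measurable _ V = <<s boxes >>.
Proof.
apply/seteqP; split.
  apply: smallest_sub; first exact: smallest_sigma_algebra.
  move=> _ [i _ [C mC <-]]; apply: sub_sigma_algebra.
  exists (fun j => if j == i then C else setT).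
    by move=> j; case: ifP.
  rewrite setTI; apply/seteqP; split => x /=.
    by move=> Cx j /=; case: eqP => // ->.
  by move=> /(_ i); rewrite eqxx.
apply: smallest_sub; first exact: sigma_algebra_measurable.
by move=> _ [E mE ->]; exact: measurable_box.
Qed.

Lemma boxes_setI : setI_closed boxes.
Proof.
move=> _ _ [E mE ->] [F mF ->]; exists (fun i => E i `&` F i).
  by move=> i; exact: measurableI.
apply/seteqP; split => x; first by move=> [Ex Fx] i; split.
by move=> EFx; split=> i; have [] := EFx i.
Qed.

Lemma boxes_setT : boxes setT.
Proof. by exists (fun=> setT) => //; apply/seteqP; split. Qed.

End boxes.

(** Names the measure structure of a pushforward, which takes the measurability proof as an
    argument. *)
Local Notation pushforward_measure :=
  measure_function_pushforward__canonical__measure_function_Measure.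

Section pi_systems.
Context {R : realType} {d : measure_display} {T : measurableType d}.
Variable P : probability T R.
Context {d' : measure_display} {V : measurableType d'}.
Variable G : set (set V).
Hypotheses (mG : @measurable _ V = <<s G >>) (GI : setI_closed G) (GT : G setT).

(** As functions of [S], the two sides are finite measures: the law of [X] restricted to [B], and
    [P B] times the law of [X]. They agree on the pi-system, hence everywhere. *)
Lemma pi_system_indep (X : T -> V) (B : set T) :
  measurable_fun setT X -> measurable B ->
  (forall S, G S -> P (X @^-1` S `&` B) = (P (X @^-1` S) * P B)%E) ->
  forall S, measurable S -> P (X @^-1` S `&` B) = (P (X @^-1` S) * P B)%E.
Proof.
move=> mX mB PG S mS.
have PB : P B = (fine (P B))%:E by rewrite fineK// fin_num_measure.
have PB0 : 0 <= fine (P B) by rewrite fine_ge0.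
pose m1 := pushforward_measure (mrestr P mB) mX.
pose m2 : {measure set V -> \bar R} :=
  mscale (NngNum PB0) (pushforward_measure P mX).
suff -> : P (X @^-1` S `&` B) = m2 S.
  change (m2 S) with ((fine (P B))%:E * P (X @^-1` S))%E.
  by rewrite -PB muleC.
apply: (measure_unique G (fun=> setT) mG GI _ _ m1 m2) => //.
- by apply/seteqP; split => // x _; exists 0%N.
- move=> A GA.
  change (P (X @^-1` A `&` B) = (fine (P B))%:E * P (X @^-1` A))%E.
  by rewrite -PB muleC; exact: PG.
- by move=> _; rewrite /m1/= /pushforward /mrestr ltey_eq fin_num_measure//;
    rewrite preimage_setT setTI.
Qed.

Lemma pi_system_law (d2 : measure_display) (T' : measurableType d2)
    (P' : probability T' R) (X : T -> V) (X' : T' -> V) :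
  measurable_fun setT X -> measurable_fun setT X' ->
  (forall S, G S -> P (X @^-1` S) = P' (X' @^-1` S)) ->
  forall S, measurable S -> P (X @^-1` S) = P' (X' @^-1` S).
Proof.
move=> mX mX' PG S mS.
pose m1 := pushforward_measure P mX.
pose m2 := pushforward_measure P' mX'.
apply: (measure_unique G (fun=> setT) mG GI _ _ m1 m2) => //.
- by apply/seteqP; split => // x _; exists 0%N.
- by move=> _; rewrite /m1/= /pushforward preimage_setT probability_setT ltry.
Qed.

End pi_systems.

Section independence.
Context {R : realType} {d : measure_display} {T : measurableType d}.
Variable P : probability T R.
Context {d1 d2 : measure_display}
  {V1 : measurableType d1} {V2 : measurableType d2}.
Variables (X : T -> V1) (Y : T -> V2).
Hypotheses (mX : measurable_fun setT X) (mY : measurable_fun setT Y).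

Lemma independent_comp {d3 d4 : measure_display}
    {V3 : measurableType d3} {V4 : measurableType d4}
    (f : V1 -> V3) (g : V2 -> V4) :
  measurable_fun setT f -> measurable_fun setT g ->
  independent P X Y -> independent P (f \o X) (g \o Y).
Proof.
move=> mf mg XY E F mE mF; apply: (XY (f @^-1` E) (g @^-1` F)).
  exact: (preimage_measurable mf).
exact: (preimage_measurable mg).
Qed.

Lemma independent_pi (G1 : set (set V1)) (G2 : set (set V2)) :
  @measurable _ V1 = <<s G1 >> -> setI_closed G1 -> G1 setT ->
  @measurable _ V2 = <<s G2 >> -> setI_closed G2 -> G2 setT ->
  (forall E F, G1 E -> G2 F ->
    P (X @^-1` E `&` Y @^-1` F) = (P (X @^-1` E) * P (Y @^-1` F))%E) ->
  independent P X Y.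
Proof.
move=> mG1 G1I G1T mG2 G2I G2T PG E F mE mF.
apply: (pi_system_indep mG1 G1I G1T mX) => //; first exact: preimage_measurable.
move=> {mE}E GE; rewrite setIC muleC.
have mE : measurable E by rewrite mG1; exact: sub_sigma_algebra.
apply: (pi_system_indep mG2 G2I G2T mY) => //; first exact: preimage_measurable.
by move=> {mF}F GF; rewrite setIC muleC; exact: PG.
Qed.

Let mXP := isMeasurableFun.Build _ _ _ _ X mX.
Let mYP := isMeasurableFun.Build _ _ _ _ Y mY.
Let RX : {mfun T >-> V1} := HB.pack X mXP.
Let RY : {mfun T >-> V2} := HB.pack Y mYP.

Let pair_law : independent P X Y -> forall D, measurable D ->
  (distribution P RX \x distribution P RY)%E D = P [set w | D (X w, Y w)].
Proof.
move=> XY D mD.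
have mXY : measurable_fun setT (fun w => (X w, Y w)) by exact: measurable_fun_pair.
pose m := pushforward_measure P mXY.
by apply: (@product_measure_unique _ _ _ _ _ _ _ m) => // E F mE mF; exact: XY.
Qed.

Lemma independent_section (D : set (V1 * V2)) : independent P X Y ->
  measurable D ->
  P [set w | D (X w, Y w)] = (\int[P]_w P [set w' | D (X w', Y w)])%E.
Proof.
move=> XY mD; rewrite -pair_law//.
(* The order of integration is exchanged so that [Y] becomes the outer, frozen variable. *)
have -> : (distribution P RX \x distribution P RY)%E D =
    (distribution P RX \x^ distribution P RY)%E D.
  by apply: product_measure_unique => // E F mE mF; exact: product_measure2E.
rewrite /product_measure2 ge0_integral_distribution//=; last first.
  exact: measurable_fun_ysection.
apply: eq_integral => w _ /=; rewrite /distribution /pushforward; congr (P _).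
by apply/seteqP; split => w' /=; rewrite /ysection/= inE.
Qed.

Lemma independent_expectationM (f : V1 -> \bar R) (g : V2 -> \bar R) :
  measurable_fun setT f -> measurable_fun setT g ->
  (forall x, (0 <= f x)%E) -> (forall y, (0 <= g y)%E) ->
  independent P X Y ->
  (\int[P]_w (f (X w) * g (Y w)) = \int[P]_w f (X w) * \int[P]_w g (Y w))%E.
Proof.
move=> mf mg f0 g0 XY.
have mXY : measurable_fun setT (fun w => (X w, Y w)) by exact: measurable_fun_pair.
have mfg : measurable_fun setT (fun z : V1 * V2 => f z.1 * g z.2)%E.
  by apply: emeasurable_funM; exact: measurableT_comp.
transitivity (\int[distribution P RX \x distribution P RY]_z (f z.1 * g z.2))%E.
  rewrite -[LHS](@ge0_integral_pushforward _ _ _ _ _ _ mXY P setT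
    (fun z => f z.1 * g z.2)%E)//; last by move=> z _; rewrite mule_ge0.
  by apply: eq_measure_integral => D mD _; apply/esym/pair_law.
rewrite fubini_tonelli1//; last by move=> z; rewrite mule_ge0.
rewrite /fubini_F /=.
under eq_integral do rewrite ge0_integralZl//.
rewrite ge0_integralZr//; last exact: integral_ge0.
by rewrite !ge0_integral_distribution.
Qed.

End independence.

(** * Rotation invariance of standard normal families *)

Section plane_rotation.
Context {R : realType}.
Local Notation mu := (@lebesgue_measure R).
Local Notation N01 := (@normal_prob R 0 1).
Local Open Scope ereal_scope.

Lemma measurable_fun_linear2 (a b c d : R) :
  measurable_fun setT (fun z : R * R =>
    ((a * z.1 + b * z.2)%R, (c * z.1 + d * z.2)%R)).
Proof.
by apply: measurable_fun_pair; apply: measurable_funD;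
  apply: measurable_funM => //; exact: measurable_cst.
Qed.

(* Substituting first [u = c x + s y] in the inner integral and then
   [v = (y - s u) / c], the two Jacobians [1/c] and [c] cancel. *)
Lemma integral2_lebesgue_rotation (c s : R) (H : R * R -> \bar R) :
  (0 < c)%R -> (c ^+ 2 + s ^+ 2 = 1)%R ->
  measurable_fun setT H -> (forall z, 0 <= H z) ->
  \int[mu]_x \int[mu]_y H ((c * x + s * y)%R, (- s * x + c * y)%R) =
  \int[mu]_x \int[mu]_y H (x, y).
Proof.
move=> c0 cs mH H0.
have c0' : c != 0%R by rewrite gt_eqF.
have mH1 := measurableT_comp mH (measurable_fun_linear2 c s (- s) c).
(* With [u = c x + s y], the second coordinate is [- (s / c) u + y / c] because
   [c ^+ 2 + s ^+ 2 = 1]; this is the integrand between the two substitutions. *)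
have mH2 := measurableT_comp mH (measurable_fun_linear2 1 0 (- (s / c)) (c^-1)).
have /= -> := @fubini_tonelli _ _ _ _ R mu mu (fun z : R * R =>
  H ((c * z.1 + s * z.2)%R, (- s * z.1 + c * z.2)%R)) mH1 (fun=> H0 _).
transitivity (\int[mu]_y (c^-1%:E * \int[mu]_x
    H ((1 * x + 0 * y)%R, (- (s / c) * x + c^-1 * y)%R))).
  apply: eq_integral => y _.
  rewrite -(ge0_integral_affine (s * y)%R (f := fun x =>
    H ((1 * x + 0 * y)%R, (- (s / c) * x + c^-1 * y)%R)))//; last first.
    exact: (measurableT_comp mH2 (pair2_measurable y)).
  apply: eq_integral => x _; congr (H (_, _)); first by ring.
  have -> : (c * y = (c ^+ 2 + s ^+ 2 - s ^+ 2) / c * y)%R.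
    by rewrite addrK expr2 mulfK.
  by rewrite cs; field.
rewrite ge0_integralZl//; last 3 first.
- exact: (@measurable_fun_fubini_tonelli_G _ _ _ _ R mu (fun z : R * R =>
    H ((1 * z.1 + 0 * z.2)%R, (- (s / c) * z.1 + c^-1 * z.2)%R)) mH2).
- by move=> y _; exact: integral_ge0.
- by rewrite lee_fin invr_ge0 ltW.
have /= <- := @fubini_tonelli _ _ _ _ R mu mu (fun z : R * R =>
  H ((1 * z.1 + 0 * z.2)%R, (- (s / c) * z.1 + c^-1 * z.2)%R)) mH2 (fun=> H0 _).
transitivity (c^-1%:E * \int[mu]_x (c%:E * \int[mu]_y H (x, y))).
  congr (_ * _); apply: eq_integral => x _.
  have := @ge0_integral_affine R c^-1 (- (s / c) * x)%R (fun y => H (x, y)).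
  rewrite invr_gt0 invrK => <-//; last first.
    exact: (measurableT_comp mH (pair1_measurable x)).
  by apply: eq_integral => y _; congr (H (_, _)); ring.
rewrite ge0_integralZl//; last 3 first.
- exact: (@measurable_fun_fubini_tonelli_F _ _ _ _ R mu H mH H0).
- by move=> y _; exact: integral_ge0.
- by rewrite lee_fin ltW.
by rewrite muleA -EFinM mulVf// mul1e.
Qed.

Lemma integral2_normal_prob (h : R * R -> \bar R) :
  measurable_fun setT h -> (forall z, 0 <= h z) ->
  \int[N01]_x \int[N01]_y h (x, y) =
  \int[mu]_x \int[mu]_y (h (x, y) * (normal_pdf 0 1 x * normal_pdf 0 1 y)%:E).
Proof.
move=> mh h0; rewrite ge0_integral_normal_prob//; last 2 first.
- exact: (@measurable_fun_fubini_tonelli_F _ _ _ _ R N01 h mh h0).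
- by move=> x; exact: integral_ge0.
have mpdf : measurable_fun setT (fun y : R => (normal_pdf 0 1 y)%:E).
  by apply/measurable_EFinP; exact: measurable_normal_pdf.
have mhx x : measurable_fun setT (fun y => h (x, y)).
  exact: (measurableT_comp mh (pair1_measurable x)).
apply: eq_integral => x _; rewrite ge0_integral_normal_prob//.
rewrite -ge0_integralZr//.
- by apply: eq_integral => y _; rewrite EFinM muleAC muleA.
- by apply: emeasurable_funM; [exact: mhx|exact: mpdf].
- by move=> y _; rewrite mule_ge0// lee_fin normal_pdf_ge0.
- by rewrite lee_fin normal_pdf_ge0.
Qed.

(** The joint density depends on [x ^+ 2 + y ^+ 2] alone, so in the Lebesgue integral the rotation
    acts only on the indicator of [A]*[B]. *)
Lemma normal_prob_rotation_gt0 (c s : R) (A B : set R) : (0 < c)%R ->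
  (c ^+ 2 + s ^+ 2 = 1)%R -> measurable A -> measurable B ->
  (N01 \x N01) [set z | A (c * z.1 + s * z.2)%R /\ B (- s * z.1 + c * z.2)%R] =
  N01 A * N01 B.
Proof.
move=> c0 cs mA mB.
have mD : measurable (A `*` B) by exact: measurableX.
have mlin := measurable_fun_linear2 c s (- s) c.
set D := [set _ | _]; have -> : D = (fun z : R * R =>
  ((c * z.1 + s * z.2)%R, (- s * z.1 + c * z.2)%R)) @^-1` (A `*` B) by [].
have m1 : measurable_fun setT (fun z : R * R => (\1_(A `*` B) z : R)%:E).
  by apply/measurable_EFinP; exact: measurable_indic.
have prodE (f : R * R -> R * R) : measurable_fun setT f ->
    (N01 \x N01) (f @^-1` (A `*` B)) =
    \int[N01]_x \int[N01]_y (\1_(A `*` B) (f (x, y)) : R)%:E.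
  move=> mf; have mfD := preimage_measurable mf mD.
  transitivity (\int[N01 \x N01]_z (\1_(f @^-1` (A `*` B)) z : R)%:E).
    by rewrite integral_indic; [rewrite setIT|exact: measurableT|exact: mfD].
  rewrite fubini_tonelli1//.
  by apply/measurable_EFinP/measurable_indic.
rewrite (prodE _ mlin).
have <- : (N01 \x N01) (id @^-1` (A `*` B)) = N01 A * N01 B.
  exact: product_measure1E.
rewrite (prodE id (@measurable_id _ _ _)).
have n1 z : 0 <= (\1_(A `*` B) z : R)%:E by rewrite lee_fin.
have sqE (x y : R) :
    ((c * x + s * y) ^+ 2 + (- s * x + c * y) ^+ 2 = x ^+ 2 + y ^+ 2)%R.
  by rewrite -[RHS]mul1r -cs; ring.
have pdfM x y : (normal_pdf 0 1 x * normal_pdf 0 1 y =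
    normal_peak 1 ^+ 2 * expR (- (x ^+ 2 + y ^+ 2) / (1 ^+ 2 *+ 2)) :> R)%R.
  by rewrite !normal_pdf0E ?oner_eq0// mulrACA -expRD -mulrDl -opprD expr2.
apply: etrans (integral2_normal_prob (measurableT_comp m1 mlin) (fun=> n1 _)) _.
apply/esym; apply: etrans (integral2_normal_prob m1 n1) _.
pose H z := (\1_(A `*` B) z : R)%:E * (normal_pdf 0 1 z.1 * normal_pdf 0 1 z.2)%:E.
have mH : measurable_fun setT H.
  apply: emeasurable_funM => //; apply/measurable_EFinP; apply: measurable_funM;
  by apply: measurableT_comp => //; exact: measurable_normal_pdf.
have H0 z : 0 <= H z.
  by rewrite mule_ge0// ?lee_fin// mulr_ge0// normal_pdf_ge0.
apply: etrans (esym (integral2_lebesgue_rotation c0 cs mH H0)) _.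
apply: eq_integral => x _; apply: eq_integral => y _; rewrite /H /=.
by rewrite !pdfM sqE.
Qed.

Lemma normal_prob_rotation (c s : R) (A B : set R) :
  (c ^+ 2 + s ^+ 2 = 1)%R -> measurable A -> measurable B ->
  (N01 \x N01) [set z | A (c * z.1 + s * z.2)%R /\ B (- s * z.1 + c * z.2)%R] =
  N01 A * N01 B.
Proof.
move=> cs mA mB.
have mN (E : set R) : measurable E -> measurable (-%R @^-1` E).
  by move=> mE; apply: preimage_measurable.
(* For [c = 0] the map exchanges the coordinates and changes one sign; for [c < 0] negating both
   coordinates leads back to [c > 0]. *)
have [c0|c0|c0] := ltgtP c 0%R; last first.
- have : ((s == 1) || (s == -1))%R.
    by rewrite -sqrf_eq1 -cs c0 expr0n add0r.
  move=> /orP[] /eqP ->.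
    rewrite (_ : [set _ | _] = (-%R @^-1` B) `*` A).
      by rewrite product_measure1E//=; [rewrite normal_probN// muleC|exact: mN].
    apply/seteqP; split => z /=; rewrite c0 !mul0r !add0r !addr0 mul1r mulN1r;
    by move=> [].
  rewrite (_ : [set _ | _] = B `*` (-%R @^-1` A)).
    by rewrite product_measure1E//=; [rewrite normal_probN// muleC|exact: mN].
  apply/seteqP; split => z /=; rewrite c0 !mul0r !add0r !addr0 opprK mul1r mulN1r;
  by move=> [].
- exact: normal_prob_rotation_gt0.
- rewrite -(normal_probN mA) -(normal_probN mB).
  rewrite -(@normal_prob_rotation_gt0 (- c) (- s) _ _ _ _ (mN _ mA) (mN _ mB));
    [|by rewrite oppr_gt0|by rewrite !sqrrN].
  congr ((_ \x _) _); apply/seteqP; split => z /=;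
  by rewrite !opprD !mulNr !opprK.
Qed.

End plane_rotation.

Section standard_normal_families.
Context {R : realType} {d : measure_display} {T : measurableType d}.
Variable P : probability T R.
Local Notation N01 := (@normal_prob R 0 1).

Definition std_normal (I : finType) (X : T -> {ffun I -> R}) : Prop :=
  measurable_fun setT X /\
  forall E : I -> set R, (forall i, measurable (E i)) ->
    P (X @^-1` box E) = (\prod_i N01 (E i))%E.

Definition dot (I : finType) (x y : {ffun I -> R}) : R := \sum_i x i * y i.

Definition rotation (I : finType) (a b : I) (c s : R) (x : {ffun I -> R}) :
  {ffun I -> R} :=
  [ffun i => if i == a then c * x a + s * x b
             else if i == b then - s * x a + c * x b else x i].

Definition flip (I : finType) (a : I) (x : {ffun I -> R}) : {ffun I -> R} :=
  [ffun i => if i == a then - x a else x i].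

Lemma measurable_rotation (I : finType) (a b : I) (c s : R) :
  measurable_fun setT (rotation a b c s).
Proof.
apply: measurable_fun_ffunP => i; rewrite /rotation.
under eq_fun do rewrite ffunE.
case: (i == a); [|case: (i == b)]; last exact: measurable_coordinate.
- by apply: measurable_funD; apply: measurable_funM => //;
    exact: measurable_coordinate.
- by apply: measurable_funD; apply: measurable_funM => //;
    exact: measurable_coordinate.
Qed.

Lemma measurable_flip (I : finType) (a : I) : measurable_fun setT (flip a).
Proof.
apply: measurable_fun_ffunP => i; rewrite /flip.
under eq_fun do rewrite ffunE.
case: (i == a); last exact: measurable_coordinate.
by apply: measurableT_comp => //; exact: measurable_coordinate.
Qed.

Lemma dot_rotation (I : finType) (a b : I) (c s : R) (x y : {ffun I -> R}) :
  a != b -> c ^+ 2 + s ^+ 2 = 1 ->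
  dot (rotation a b c s x) (rotation a b c s y) = dot x y.
Proof.
move=> ab cs; have ba : b != a by rewrite eq_sym.
rewrite /dot (bigD1 a)//= [RHS](bigD1 a)//= (bigD1 b)//=.
rewrite [X in _ = _ + X](bigD1 b)//=.
rewrite !ffunE !eqxx (eq_sym b a) (negbTE ab) !addrA; congr (_ + _).
  by rewrite -[RHS]mul1r -cs; ring.
by apply: eq_bigr => i /andP[ia ib]; rewrite !ffunE (negbTE ia) (negbTE ib).
Qed.

Lemma dot_flip (I : finType) (a : I) (x y : {ffun I -> R}) :
  dot (flip a x) (flip a y) = dot x y.
Proof.
rewrite /dot (bigD1 a)//= [RHS](bigD1 a)//= !ffunE eqxx mulrNN; congr (_ + _).
by apply: eq_bigr => i ia; rewrite !ffunE (negbTE ia).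
Qed.

(** On the event [rest], which constrains every coordinate except [a] and [b], the pair at [a] and
    [b] is distributed as a constant [k] times a product of two standard normal laws; the plane case
    then applies to the pair. *)
Lemma std_normal_rotation (I : finType) (a b : I) (c s : R)
    (X : T -> {ffun I -> R}) : a != b -> c ^+ 2 + s ^+ 2 = 1 ->
  std_normal X -> std_normal (rotation a b c s \o X).
Proof.
move=> ab cs [mX PX]; have mXi i : measurable_fun setT (fun w => X w i).
  exact: measurableT_comp (measurable_coordinate i) mX.
split; first exact: measurableT_comp (measurable_rotation a b c s) mX.
move=> E mE.
pose upd (A B : set R) i := if i == a then A else if i == b then B else E i.
have mupd A B : measurable A -> measurable B -> forall i, measurable (upd A B i).
  by move=> mA mB i; rewrite /upd; case: ifP => // _; case: ifP.
pose k := (\prod_(i | (i != a) && (i != b)) N01 (E i))%E.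
have prodE A B : (\prod_i N01 (upd A B i) = k * N01 A * N01 B)%E.
  rewrite (bigD1 a)//= (bigD1 b) 1?eq_sym//= /upd !eqxx (eq_sym b a) (negbTE ab).
  rewrite [X in (_ * (_ * X))%E](_ : _ = k); first by rewrite muleA muleC muleA.
  by apply: eq_bigr => i /andP[ia ib]; rewrite (negbTE ia) (negbTE ib).
have kfin : k \is a fin_num.
  rewrite /k; elim/big_ind : _ => // [x y|i _]; first exact: fin_numM.
  by apply: fin_num_measure; exact: mE.
have k0 : (0 <= fine k) by rewrite fine_ge0// /k prode_ge0.
have kE : k = (fine k)%:E by rewrite fineK.
pose rest := X @^-1` box (upd setT setT).
have mrest : measurable rest.
  by apply: preimage_measurable => //; apply: measurable_box; exact: mupd.
pose Xab w : measurableTypeR R * measurableTypeR R := (X w a, X w b).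
have mXab : measurable_fun setT Xab := measurable_fun_pair (mXi a) (mXi b).
pose m := pushforward_measure (mrestr P mrest) mXab.
(* The constant is absorbed into the first marginal, so that uniqueness of the product measure
   identifies [m]. *)
pose kN : {sigma_finite_measure set (measurableTypeR R) -> \bar R} :=
  mscale (NngNum k0) N01.
pose D := [set z : R * R | E a (c * z.1 + s * z.2) /\ E b (- s * z.1 + c * z.2)].
have mD : measurable D.
  exact: (preimage_measurable (measurable_fun_linear2 c s (- s) c)
    (measurableX (mE a) (mE b))).
have mrect A B : measurable A -> measurable B ->
    m (A `*` B) = (kN A * N01 B)%E.
  move=> mA mB; change (m (A `*` B) = ((fine k)%:E * N01 A * N01 B)%E).
  rewrite -kE -prodE -PX; last exact: mupd.
  rewrite /m/= /pushforward /mrestr; congr (P _).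
  apply/seteqP; split => w /=.
    move=> [[/= Aw Bw] restw] i; have := restw i; rewrite /upd.
    by case: eqP => [->//|_]; case: eqP => [->|].
  move=> Xw; split; last first.
    move=> i; have := Xw i; rewrite /upd.
    by case: eqP => //; case: eqP.
  split; first by have := Xw a; rewrite /upd eqxx.
  by have := Xw b; rewrite /upd eqxx eq_sym (negbTE ab).
transitivity (m D).
  rewrite /m/= /pushforward /mrestr; congr (P _); apply/seteqP; split => w /=.
    move=> Xw; split; first split => /=.
    - by have := Xw a; rewrite ffunE eqxx.
    - by have := Xw b; rewrite ffunE eqxx eq_sym (negbTE ab).
    move=> i; have := Xw i; rewrite ffunE /upd.
    by case: eqP => // _; case: eqP.
  move=> [[/= Ea Eb] restw] i; rewrite ffunE; have := restw i; rewrite /upd.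
  by case: eqP => [->//|_]; case: eqP => [->|].
rewrite -(@product_measure_unique _ _ _ _ R kN N01 m mrect)//.
have -> : (kN \x N01)%E D = ((fine k)%:E * (N01 \x N01) D)%E.
  by apply: ge0_integral_mscale => //; exact: measurable_fun_xsection.
rewrite normal_prob_rotation// -kE muleA -prodE.
apply: eq_bigr => i _; rewrite /upd.
by case: eqP => [->//|_]; case: eqP => [->|].
Qed.

Lemma std_normal_flip (I : finType) (a : I) (X : T -> {ffun I -> R}) :
  std_normal X -> std_normal (flip a \o X).
Proof.
move=> [mX PX]; split; first exact: measurableT_comp (measurable_flip a) mX.
move=> E mE; have mN : measurable (-%R @^-1` E a) by exact: preimage_measurable.
rewrite (_ : _ @^-1` _ =
  X @^-1` box (fun i => if i == a then -%R @^-1` E a else E i)); last first.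
  apply/seteqP; split => w /= Xw i; have := Xw i; rewrite ffunE;
  by case: eqP => // ->.
rewrite PX => [|i]; last by case: ifP.
by apply: eq_bigr => i _; case: eqP => // ->; rewrite normal_probN.
Qed.

Lemma std_normal_reindex (I J : finType) (f : J -> I) (X : T -> {ffun I -> R}) :
  injective f -> std_normal X -> std_normal (fun w => [ffun j => X w (f j)]).
Proof.
move=> injf [mX PX]; split.
  apply: measurable_fun_ffunP => j; under eq_fun do rewrite ffunE.
  exact: measurableT_comp (measurable_coordinate (f j)) mX.
(* Coordinates outside the image of [f] are unconstrained and contribute a factor 1. *)
move=> E mE; pose E' i := if [pick j | f j == i] is Some j then E j else setT.
have E'f j : E' (f j) = E j.
  rewrite /E'; case: pickP => [j' /eqP/injf ->//|/(_ j)]; by rewrite eqxx.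
rewrite (_ : _ @^-1` _ = X @^-1` box E'); last first.
  apply/seteqP; split => w /= Xw.
    move=> i; rewrite /E'; case: pickP => // j /eqP <-.
    by have := Xw j; rewrite ffunE.
  by move=> j; rewrite ffunE -E'f; exact: Xw.
rewrite PX => [|i]; last by rewrite /E'; case: pickP.
rewrite (bigID (mem (codom f)))/= [X in (_ * X)%E]big1 ?mule1; last first.
  move=> i fi; rewrite /E'; case: pickP => [j /eqP ji|_]; last exact: probability_setT.
  by case/negP: fi; rewrite -ji codom_f.
have uc : uniq (codom f) by rewrite map_inj_uniq ?enum_uniq.
rewrite -(big_uniq _ uc) /codom /image_mem big_map big_enum/=.
by apply: eq_bigr => j _; rewrite E'f.
Qed.

End standard_normal_families.

(** * Alignment of orthonormal families with coordinate vectors *)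

Section orthonormal_families.
Context {R : realType} {d : measure_display} {T : measurableType d}.
Variable P : probability T R.

Definition unit_vector (I : finType) (a : I) : {ffun I -> R} :=
  [ffun i => (i == a)%:R].

Lemma dot_unit_vector (I : finType) (a : I) (x : {ffun I -> R}) :
  dot (unit_vector a) x = x a.
Proof.
rewrite /dot (bigD1 a)//= ffunE eqxx mul1r big1 ?addr0// => i ia.
by rewrite ffunE (negbTE ia) mul0r.
Qed.

Lemma dotC (I : finType) (x y : {ffun I -> R}) : dot x y = dot y x.
Proof. by apply: eq_bigr => i _; rewrite mulrC. Qed.

(** Both properties pass to compositions. Once [L u] is a unit vector, the first one reads off a
    coordinate of [L x] as [dot u x]. *)
Definition normal_isometry (I : finType) (L : {ffun I -> R} -> {ffun I -> R}) :
  Prop :=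
  (forall x y, dot (L x) (L y) = dot x y) /\
  (forall X : T -> {ffun I -> R}, std_normal P X -> std_normal P (L \o X)).

Lemma rotation_unit_vector (I : finType) (a b j : I) (c s : R) :
  j != a -> j != b -> rotation a b c s (unit_vector j) = unit_vector j.
Proof.
move=> ja jb; apply/ffunP => i; rewrite !ffunE.
rewrite (eq_sym a j) (negbTE ja) (eq_sym b j) (negbTE jb) !mulr0 addr0.
have [->|ia] := eqVneq i a; first by rewrite eq_sym (negbTE ja).
by have [->|ib] := eqVneq i b; first by rewrite eq_sym (negbTE jb).
Qed.

Lemma flip_unit_vector (I : finType) (a j : I) :
  j != a -> flip a (unit_vector j) = unit_vector j :> {ffun I -> R}.
Proof.
move=> ja; apply/ffunP => i; rewrite !ffunE.
have [->|//] := eqVneq i a; by rewrite eq_sym (negbTE ja) oppr0.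
Qed.

(** Each plane rotation moves the mass of one nonzero coordinate of [u] into coordinate [a], so the
    induction is on the number of nonzero coordinates other than [a]; at the end [u] is the unit
    vector at [a] up to a sign. The clause about fixed unit vectors keeps previously aligned vectors
    in place. *)
Lemma normal_isometry_align (I : finType) (a : I) (n : nat) (u : {ffun I -> R}) :
  (#|[set i | (i != a) && (u i != 0)%R]%SET| <= n)%N -> dot u u = 1 ->
  exists L, [/\ normal_isometry L,
    (forall j, j != a -> u j = 0 -> L (unit_vector j) = unit_vector j) &
    L u = unit_vector a].
Proof.
elim: n u => [|n IHn] u.
  rewrite leqn0 cards_eq0 => /eqP S0 uu.
  have u0 i : i != a -> u i = 0.
    move=> ia; apply/eqP; apply: contraT => ui.
    by move/setP : S0 => /(_ i); rewrite !inE ia ui.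
  have : u a ^+ 2 = 1.
    rewrite -uu /dot (bigD1 a)//= big1 ?addr0 ?expr2// => i ia.
    by rewrite u0// mul0r.
  move=> /eqP; rewrite sqrf_eq1 => /orP[] /eqP ua.
  - exists idfun; split => //; apply/ffunP => i /=; rewrite ffunE.
    by have [->|ia] := eqVneq i a; [rewrite ua|rewrite u0].
  - exists (flip a); split.
    + by split; [exact: dot_flip|exact: std_normal_flip].
    + by move=> j ja _; exact: flip_unit_vector.
    + apply/ffunP => i; rewrite !ffunE.
      by have [_|ia] := eqVneq i a; [rewrite ua opprK|rewrite u0].
move=> un uu.
have [S0|[b]] := set_0Vmem [set i | (i != a) && (u i != 0)%R]%SET.
  by apply: IHn => //; rewrite S0 cards0.
rewrite inE => /andP[ba ub].
have ab : a != b by rewrite eq_sym.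
(* With cosine [u a / rho] and sine [u b / rho], the rotated vector vanishes at [b]. *)
pose rho := Num.sqrt (u a ^+ 2 + u b ^+ 2).
have rho0 : 0 < rho.
  by rewrite sqrtr_gt0 ltr_wpDl// ?sqr_ge0// exprn_even_gt0.
have rho2 : rho ^+ 2 = u a ^+ 2 + u b ^+ 2 by rewrite sqr_sqrtr// addr_ge0// sqr_ge0.
have cs : (u a / rho) ^+ 2 + (u b / rho) ^+ 2 = 1.
  by rewrite !expr_div_n -mulrDl -rho2 divff// gt_eqF// exprn_gt0.
pose G := rotation a b (u a / rho) (u b / rho).
have Gu i : i != a -> i != b -> G u i = u i.
  by move=> ia ib; rewrite ffunE (negbTE ia) (negbTE ib).
have Gub : G u b = 0.
  by rewrite ffunE (negbTE ba) eqxx; field; rewrite gt_eqF.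
have Gu1 : dot (G u) (G u) = 1 by rewrite dot_rotation.
have [||L [[Ldot LX] Lj Lu]] := IHn (G u) => //.
  rewrite -ltnS; apply: leq_trans un; apply: proper_card; apply/properP; split.
    apply/fintype.subsetP => i; rewrite !inE => /andP[ia]; rewrite ia /=.
    have [->|ib] := eqVneq i b; first by rewrite Gub eqxx.
    by rewrite Gu.
  by exists b; rewrite !inE ?ba ?ub// Gub eqxx.
exists (L \o G); split.
- split; first by move=> x y; rewrite /= Ldot dot_rotation.
  by move=> X NX; apply: (LX (G \o X)); exact: std_normal_rotation.
(* A coordinate where [u] vanishes cannot be [b], so the rotation also fixes its unit vector. *)
- move=> j ja uj /=; have jb : j != b by apply: contraNneq ub => <-; rewrite uj.
  by rewrite /G rotation_unit_vector// Lj// Gu.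
- exact: Lu.
Qed.

Definition orthonormal_family (B I : finType) (c : B -> {ffun I -> R}) : Prop :=
  forall b b', dot (c b) (c b') = (b == b')%:R.

(** Vectors are aligned one at a time. The image of the next vector is orthogonal to the unit
    vectors already reached, so it vanishes at their coordinates, and aligning it leaves them
    fixed. *)
Lemma normal_isometry_align_family (B I : finType) (c : B -> {ffun I -> R})
    (f : B -> I) : injective f -> orthonormal_family c ->
  exists2 L, normal_isometry L & forall b, L (c b) = unit_vector (f b).
Proof.
move=> injf oc.
suff H (s : seq B) : uniq s -> exists2 L, normal_isometry L &
    forall b, b \in s -> L (c b) = unit_vector (f b).
  have [L isoL Lc] := H (enum B) (enum_uniq _).
  by exists L => // b; apply: Lc; rewrite mem_enum.
elim: s => [_|b s IHs /=/andP[bs us]]; first by exists idfun.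
have [L [Ldot LX] Lc] := IHs us.
have Lb1 : dot (L (c b)) (L (c b)) = 1 by rewrite Ldot oc eqxx.
have [L' [[L'dot L'X] L'j L'b]] := normal_isometry_align
  (leqnn #|[set i | (i != f b) && (L (c b) i != 0)%R]%SET|) Lb1.
exists (L' \o L).
  split; first by move=> x y; rewrite /= L'dot Ldot.
  by move=> X NX; apply: (L'X (L \o X)); exact: LX.
move=> b'; rewrite inE => /predU1P[->//|b's] /=.
have bb' : b' != b by apply: contraNneq bs => <-.
rewrite Lc// L'j//; first by rewrite (inj_eq injf).
by rewrite -dot_unit_vector -Lc// Ldot oc (negbTE bb').
Qed.

(** After alignment, the inner product with [c b] is coordinate [f b] of [L \o X], so the family is
    a subfamily of a standard normal one. *)
Lemma std_normal_orthonormal (B I : finType) (c : B -> {ffun I -> R})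
    (f : B -> I) (X : T -> {ffun I -> R}) :
  injective f -> orthonormal_family c -> std_normal P X ->
  std_normal P (fun w => [ffun b => dot (c b) (X w)]).
Proof.
move=> injf oc NX; have [L [Ldot LX] Lc] := normal_isometry_align_family injf oc.
have := std_normal_reindex injf (LX _ NX); congr (std_normal P _).
apply/funext => w; apply/ffunP => b; rewrite !ffunE /=.
by rewrite -dot_unit_vector -Lc Ldot.
Qed.

Lemma std_normal_sum_independent (B C : finType) (X : T -> {ffun B + C -> R}) :
  std_normal P X ->
  independent P (fun w => [ffun b => X w (inl b)])
                (fun w => [ffun c => X w (inr c)]).
Proof.
move=> NX.
have injl : injective (@inl B C) by move=> ? ? [].
have injr : injective (@inr B C) by move=> ? ? [].
have [ml Pl] := std_normal_reindex injl NX.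
have [mr Pr] := std_normal_reindex injr NX.
have [mX PX] := NX.
apply: (independent_pi ml mr (measurable_boxesE _) (@boxes_setI _ _)
  (boxes_setT _) (measurable_boxesE _) (@boxes_setI _ _) (boxes_setT _)).
move=> _ _ [E mE ->] [F mF ->]; rewrite Pl// Pr//.
pose G (i : B + C) := match i with inl b => E b | inr c => F c end.
have := PX G; rewrite big_sumType/= => <-; last by case.
congr (P _); apply/seteqP; split => w /=.
  move=> [Ew Fw] [b|c] /=; first by have := Ew b; rewrite ffunE.
  by have := Fw c; rewrite ffunE.
move=> Gw; split => [b|c]; rewrite ffunE; first exact: (Gw (inl b)).
exact: (Gw (inr c)).
Qed.

Lemma measurable_dot (I : finType) (u : {ffun I -> R}) :
  measurable_fun setT (dot u).
Proof.
apply: measurable_sum => i; apply: measurable_funM => //.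
exact: measurable_coordinate.
Qed.

(** After alignment, the products with [c] are the coordinates in the image of [f], while each
    [L (g k)] vanishes there, so the products with [g] depend on the other coordinates only. The
    [g k] may be linearly dependent, as the deviation vectors are. *)
Lemma std_normal_orthogonal_independent (B K I : finType)
    (c : B -> {ffun I -> R}) (g : K -> {ffun I -> R}) (f : B -> I)
    (X : T -> {ffun I -> R}) :
  injective f -> orthonormal_family c -> (forall k b, dot (g k) (c b) = 0) ->
  std_normal P X ->
  independent P (fun w => [ffun b => dot (c b) (X w)])
                (fun w => [ffun k => dot (g k) (X w)]).
Proof.
move=> injf oc gc NX.
have [L [Ldot LX] Lc] := normal_isometry_align_family injf oc.
pose C := {i | i \in [predC codom f]}.
pose h (i : B + C) := match i with inl b => f b | inr c => val c end.
have injh : injective h.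
  move=> [b|k] [b'|k'] //=; first by move=> /injf ->.
  - by move=> bk; have := valP k'; rewrite inE /= -bk codom_f.
  - by move=> kb; have := valP k; rewrite inE /= kb codom_f.
  - by move=> /val_inj ->.
have NY := std_normal_reindex injh (LX _ NX).
have XY := std_normal_sum_independent NY.
(* Recovers the products with [g] from the coordinates outside the image of [f]. *)
pose q (y : {ffun C -> R}) := [ffun k => \sum_j L (g k) (val j) * y j] : {ffun K -> R}.
have mq : measurable_fun setT q.
  apply: measurable_fun_ffunP => k.
  have -> : (fun y => q y k) = (fun y => \sum_j L (g k) (val j) * y j).
    by apply/funext => y; rewrite ffunE.
  apply: measurable_sum => j; apply: measurable_funM => //.
  exact: measurable_coordinate.
have := independent_comp (@measurable_id _ _ setT) mq XY.
congr (independent P _ _); apply/funext => w; apply/ffunP => k; rewrite !ffunE /=.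
  by rewrite -dot_unit_vector -Lc Ldot.
rewrite -Ldot /dot (bigID (mem (codom f)))/= [X in _ = X + _]big1 ?add0r.
  transitivity (\sum_(j : C) L (g k) (val j) * L (X w) (val j)).
    by apply: eq_bigr => j _; rewrite !ffunE.
  rewrite -(big_sub [predC codom f] (fun i => L (g k) i * L (X w) i)).
  by apply: eq_bigl => i; rewrite inE.
move=> _ /codomP[b ->].
by rewrite -[L (g k) (f b)]dot_unit_vector -Lc Ldot dotC gc mul0r.
Qed.

End orthonormal_families.

(** * Laws and moments of linear combinations *)

Section standard_normal_integrals.
Context {R : realType} {d : measure_display} {T : measurableType d}.
Variable P : probability T R.
Local Notation N01 := (@normal_prob R 0 1).

Lemma std_normal_law (I : finType) (d' : measure_display)
    (T' : measurableType d') (P' : probability T' R)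
    (X : T -> {ffun I -> R}) (X' : T' -> {ffun I -> R}) (S : set {ffun I -> R}) :
  std_normal P X -> std_normal P' X' -> measurable S ->
  P (X @^-1` S) = P' (X' @^-1` S).
Proof.
move=> [mX PX] [mX' PX'].
apply: (pi_system_law (measurable_boxesE I) (@boxes_setI _ I) (boxes_setT I) mX mX').
by move=> _ [E mE ->]; rewrite PX// PX'.
Qed.

Lemma std_normal_coordinate (I : finType) (X : T -> {ffun I -> R}) (i : I)
    (E : set R) : std_normal P X -> measurable E ->
  P [set w | E (X w i)] = N01 E.
Proof.
move=> NX mE; have inji : injective (fun _ : 'I_1 => i).
  by move=> j k _; rewrite !ord1.
have [_ PY] := std_normal_reindex inji NX.
have <- : (\prod_(j < 1) N01 E)%E = N01 E by rewrite big_ord1.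
rewrite -(PY (fun=> E))//.
congr (P _); apply/seteqP; split => w /=; first by move=> Ew j; rewrite ffunE.
by move=> /(_ ord0); rewrite ffunE.
Qed.

Lemma std_normal_coordinate_integral (I : finType) (X : T -> {ffun I -> R})
    (i : I) (g : R -> \bar R) : std_normal P X ->
  measurable_fun setT g -> (forall x, (0 <= g x)%E) ->
  (\int[P]_w g (X w i) = \int[N01]_x g x)%E.
Proof.
move=> NX mg g0; pose Xi w : measurableTypeR R := X w i.
have mXi : measurable_fun setT Xi.
  by apply: measurableT_comp (measurable_coordinate i) _; case: NX.
rewrite -[LHS](@ge0_integral_pushforward _ _ _ _ _ _ mXi P setT g)//.
by apply: eq_measure_integral => E mE _; exact: std_normal_coordinate.
Qed.

(** The normalised [u] is an orthonormal family with one element, and [i0] is the coordinate it is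
    moved to. *)
Lemma dot_scaled_std_normal (I : finType) (i0 : I) (u : {ffun I -> R})
    (X : T -> {ffun I -> R}) : dot u u != 0 -> std_normal P X ->
  exists2 Y : T -> {ffun 'I_1 -> R}, std_normal P Y &
    forall w, dot u (X w) = Num.sqrt (dot u u) * Y w ord0.
Proof.
move=> u0 NX; set s := Num.sqrt (dot u u).
have uu0 : 0 <= dot u u by apply: sumr_ge0 => i _; rewrite -expr2 sqr_ge0.
have s0 : s != 0 by rewrite gt_eqF// sqrtr_gt0 lt_neqAle eq_sym u0.
pose c (_ : 'I_1) : {ffun I -> R} := [ffun i => s^-1 * u i].
have dotc x : dot (c ord0) x = s^-1 * dot u x.
  by rewrite /dot mulr_sumr; apply: eq_bigr => i _; rewrite ffunE mulrA.
exists (fun w => [ffun b => dot (c b) (X w)]); last first.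
  by move=> w; rewrite ffunE dotc mulrA divff// mul1r.
apply: (@std_normal_orthonormal _ _ _ _ _ _ _ (fun=> i0)) => //.
  by move=> j k _; rewrite !ord1.
move=> j k; rewrite !ord1 eqxx dotc dotC dotc mulrA -invfM -expr2.
by rewrite sqr_sqrtr// mulVf.
Qed.

Lemma dot_self_eq0 (I : finType) (u x : {ffun I -> R}) :
  dot u u = 0 -> dot u x = 0.
Proof.
move=> /eqP; rewrite psumr_eq0; last by move=> i _; rewrite -expr2 sqr_ge0.
move=> /allP u0; rewrite /dot big1// => i _.
have := u0 i (mem_index_enum _).
by rewrite /= mulf_eq0 orbb => /eqP ->; rewrite mul0r.
Qed.

Lemma std_normal_dot_law (I : finType) (i0 : I) (u : {ffun I -> R})
    (X : T -> {ffun I -> R}) (E : set R) : std_normal P X -> measurable E ->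
  P [set w | E (dot u (X w))] = normal_law 0 (dot u u) E.
Proof.
(* A vanishing [u] gives the constant 0, which is the point-mass branch of [normal_law]. *)
move=> NX mE; rewrite /normal_law; have [u0|u0] := eqVneq (dot u u) 0.
  rewrite (_ : [set _ | _] = [set _ | E 0]); last first.
    by apply/seteqP; split => w /=; rewrite dot_self_eq0.
  rewrite diracE; have [E0|E0] := boolP (0 \in E).
    rewrite (_ : [set _ | _] = setT) ?probability_setT//.
    by apply/seteqP; split => // w _ /=; rewrite -inE.
  rewrite (_ : [set _ | _] = set0) ?measure0//.
  by apply/seteqP; split => // w /= /mem_set; rewrite (negbTE E0).
have [Y NY uX] := dot_scaled_std_normal i0 u0 NX.
have s0 : 0 < Num.sqrt (dot u u).
  rewrite sqrtr_gt0 lt_neqAle eq_sym u0 sumr_ge0// => i _.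
  by rewrite -expr2 sqr_ge0.
rewrite -normal_prob_scale// -(std_normal_coordinate ord0 NY); last first.
  by apply: preimage_measurable => //; exact: measurable_funM.
by congr (P _); apply/seteqP; split => w /=; rewrite uX.
Qed.

Lemma std_normal_dot_sqr (I : finType) (i0 : I) (u : {ffun I -> R})
    (X : T -> {ffun I -> R}) : std_normal P X ->
  (\int[P]_w ((dot u (X w)) ^+ 2)%:E = (dot u u)%:E)%E.
Proof.
move=> NX; have [u0|u0] := eqVneq (dot u u) 0.
  rewrite u0 integral0_eq// => w _.
  by rewrite dot_self_eq0// expr0n.
have [Y NY uX] := dot_scaled_std_normal i0 u0 NX.
have uu0 : 0 <= dot u u by apply: sumr_ge0 => i _; rewrite -expr2 sqr_ge0.
have msqr : measurable_fun setT (fun x : R => (x ^+ 2)%:E).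
  by apply/measurable_EFinP; exact: measurable_funX.
under eq_integral do rewrite uX exprMn sqr_sqrtr// EFinM.
rewrite ge0_integralZl//; last 2 first.
- apply: (measurableT_comp msqr).
  by apply: measurableT_comp (measurable_coordinate ord0) _; case: NY.
- by move=> w _; rewrite lee_fin sqr_ge0.
rewrite (std_normal_coordinate_integral ord0 NY msqr); last first.
  by move=> x; rewrite lee_fin sqr_ge0.
by rewrite integral_normal_sqr mule1.
Qed.

(** By induction on the list: the head coordinate is independent of the others, so its factor splits
    off the expectation. *)
Lemma std_normal_integral_prod (I : finType) (X : T -> {ffun I -> R})
    (g : R -> R) (s : seq I) : std_normal P X ->
  measurable_fun setT g -> (forall x, 0 <= g x) -> uniq s ->
  (\int[P]_w (\prod_(i <- s) g (X w i))%:E =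
   \prod_(i <- s) \int[N01]_x (g x)%:E)%E.
Proof.
move=> NX mg g0; elim: s => [_|a s IHs /=/andP[as_ us]].
  under eq_integral do rewrite big_nil.
  by rewrite big_nil -[RHS](probability_setT P) -[RHS]mul1e -integral_cst.
pose c (_ : 'I_1) : {ffun I -> R} := unit_vector a.
(* The zero vector at [a] keeps the family indexed by all of [I] while making it orthogonal to
   [c]. *)
pose h (i : I) : {ffun I -> R} := if i == a then 0 else unit_vector i.
have inja : injective (fun _ : 'I_1 => a) by move=> j k _; rewrite !ord1.
have oc : orthonormal_family c.
  by move=> j k; rewrite !ord1 eqxx dot_unit_vector ffunE eqxx.
have hc k b : dot (h k) (c b) = 0.
  rewrite /h /c; have [_|ka] := eqVneq k a.
    by rewrite /dot big1// => i _; rewrite ffunE mul0r.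
  by rewrite dot_unit_vector ffunE (negbTE ka).
have XY := std_normal_orthogonal_independent inja oc hc NX.
have [mX _] := NX.
have mdots (K : finType) (f : K -> {ffun I -> R}) :
    measurable_fun setT (fun w => [ffun k => dot (f k) (X w)] : {ffun K -> R}).
  apply: measurable_fun_ffunP => k; under eq_fun do rewrite ffunE.
  exact: measurableT_comp (measurable_dot _) mX.
have mE (K : finType) (r : seq K) :
    measurable_fun setT (fun y : {ffun K -> R} => (\prod_(i <- r) g (y i))%:E).
  apply/measurable_EFinP; apply: measurable_prod => i _.
  exact: measurableT_comp mg (measurable_coordinate i).
have E0 (K : finType) (r : seq K) (y : {ffun K -> R}) :
    (0 <= (\prod_(i <- r) g (y i))%:E)%E.
  by rewrite lee_fin prodr_ge0.
have := independent_expectationM (mdots _ c) (mdots _ h)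
  (mE _ [:: ord0]) (mE _ s) (E0 _ _) (E0 _ _) XY.
rewrite big_cons -IHs// -(std_normal_coordinate_integral a NX); last 2 first.
- exact/measurable_EFinP.
- by move=> x; rewrite lee_fin.
move=> H; transitivity (\int[P]_w
    ((\prod_(i <- [:: ord0]) g ([ffun b => dot (c b) (X w)] i))%:E *
     (\prod_(i <- s) g ([ffun k => dot (h k) (X w)] i))%:E))%E.
  apply: eq_integral => w _; rewrite big_cons -EFinM big_seq1 ffunE.
  rewrite dot_unit_vector; congr (_ * _)%:E; apply: eq_big_seq => i is_.
  rewrite ffunE /h; case: eqP => [ia|_]; last by rewrite dot_unit_vector.
  by move: as_; rewrite -ia is_.
rewrite H; congr (_ * _)%E; apply: eq_integral => w _.
  by rewrite big_seq1 ffunE dot_unit_vector.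
congr EFin; apply: eq_big_seq => i is_.
rewrite ffunE /h; case: eqP => [ia|_]; last by rewrite dot_unit_vector.
by move: as_; rewrite -ia is_.
Qed.

(* Chernoff's bound with [1 - 2 lambda = sigma^-2] and
   [sigma = 1 + t / sqrt n]; the exponential moment is [sigma ^+ n]. *)
Lemma std_normal_norm_tail (I : finType) (X : T -> {ffun I -> R}) (t : R) :
  (0 < #|I|)%N -> 0 <= t -> std_normal P X ->
  ((1 - expR (- (t ^+ 2 / 2)))%:E <=
   P [set w | (Num.sqrt (dot (X w) (X w)) <= Num.sqrt #|I|%:R + t)%R])%E.
Proof.
move=> I0 t0 NX; set n := #|I|.
have n0 : 0 < n%:R :> R by rewrite ltr0n.
have sn0 : 0 < Num.sqrt n%:R :> R by rewrite sqrtr_gt0.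
pose u := t / Num.sqrt n%:R; have u0 : 0 <= u by rewrite divr_ge0// ltW.
pose sg := 1 + u; have sg0 : 0 < sg by rewrite /sg; lra.
pose l := (1 - sg ^- 2) / 2.
have l0 : 0 <= l.
  rewrite divr_ge0// subr_ge0 invf_le1 ?exprn_gt0//.
  by rewrite expr_ge1// /sg ?lerDl//; lra.
have TE : (Num.sqrt n%:R + t) ^+ 2 = n%:R * sg ^+ 2.
  have -> : Num.sqrt n%:R + t = Num.sqrt n%:R * sg.
    by rewrite /sg /u; field; rewrite gt_eqF.
  by rewrite exprMn sqr_sqrtr// ltW.
have t2 : t ^+ 2 = n%:R * u ^+ 2.
  by rewrite /u expr_div_n sqr_sqrtr ?ltW//; field; rewrite gt_eqF.
have [mX _] := NX.
pose bad := [set w | n%:R * sg ^+ 2 < dot (X w) (X w)].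
have mdot : measurable_fun setT (fun w => dot (X w) (X w)).
  apply: measurable_sum => i; apply: measurable_funM;
  exact: measurableT_comp (measurable_coordinate i) mX.
have dot0 w : 0 <= dot (X w) (X w).
  by apply: sumr_ge0 => i _; rewrite -expr2 sqr_ge0.
have mbad : measurable bad.
  rewrite (_ : bad = (fun w => dot (X w) (X w)) @^-1` `]n%:R * sg ^+ 2, +oo[).
    exact: preimage_measurable.
  by apply/seteqP; split => w /=; rewrite in_itv/= andbT.
have -> : [set w | Num.sqrt (dot (X w) (X w)) <= Num.sqrt n%:R + t] = ~` bad.
  apply/seteqP; split => w /=.
    move=> H; apply/negP; rewrite -leNgt -TE -[leLHS]sqr_sqrtr//.
    by rewrite lerXn2r ?nnegrE ?sqrtr_ge0// addr_ge0// sqrtr_ge0.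
  move=> /negP; rewrite -leNgt -TE => H.
  by rewrite -(ler_pXn2r (n := 2)) ?nnegrE ?sqrtr_ge0 ?addr_ge0 ?sqrtr_ge0// sqr_sqrtr.
rewrite probability_setC// EFinB; apply: leeB => //.
pose g (x : R) := expR (l * x ^+ 2).
have mg : measurable_fun setT g.
  by apply: measurableT_comp => //; apply: measurable_funM => //;
    exact: measurable_funX.
have mprod : measurable_fun setT (fun w => (\prod_(i <- enum I) g (X w i))%:E).
  apply/measurable_EFinP; apply: measurable_prod => i _.
  apply: measurableT_comp mg _.
  exact: measurableT_comp (measurable_coordinate i) mX.
have prodE w : \prod_(i <- enum I) g (X w i) = expR (l * dot (X w) (X w)).
  rewrite big_enum /dot mulr_sumr expR_sum; apply: eq_bigr => i _.
  by rewrite /g expr2.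
(* Markov's inequality for the exponential of [l] times the squared norm, which is a product over
   the coordinates. *)
have Pbad : (P bad <= (expR (- (l * (n%:R * sg ^+ 2))))%:E *
    \int[P]_w (\prod_(i <- enum I) g (X w i))%:E)%E.
  rewrite -ge0_integralZl//; last first.
    by move=> w _; rewrite lee_fin prodE expR_ge0.
  have -> : P bad = (\int[P]_w (\1_bad w : R)%:E)%E.
    by rewrite integral_indic; [rewrite setIT|exact: measurableT|exact: mbad].
  apply: ge0_le_integral => //.
  - by apply/measurable_EFinP; exact: measurable_indic.
  - exact: emeasurable_funM.
  - move=> w _; rewrite -EFinM lee_fin prodE -expRD indicE.
    have [wb|_] := boolP (w \in bad); last exact: expR_ge0.
    rewrite -[leLHS]expR0 ler_expR addrC -mulrBr mulr_ge0// subr_ge0 ltW//.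
    by move: wb; rewrite inE.
apply: (le_trans Pbad).
rewrite std_normal_integral_prod ?enum_uniq// => [|x]; last exact: expR_ge0.
rewrite (eq_bigr (fun=> sg%:E)) => [|i _]; last exact: integral_normal_exp_sqr.
rewrite prodEFin big_enum prodr_const -/n -EFinM lee_fin.
have -> : - (l * (n%:R * sg ^+ 2)) = - ((sg ^+ 2 - 1) / 2) * n%:R.
  by rewrite /l; field; rewrite gt_eqF.
have -> : - (t ^+ 2 / 2) = - (u ^+ 2 / 2) * n%:R by rewrite t2; ring.
rewrite mulrC !expRM_natr -exprMn.
apply: lerXn2r; rewrite ?nnegrE ?mulr_ge0 ?expR_ge0//.
  exact: ltW.
(* It is enough to compare the bases of the two [n]-th powers. Since [sg = 1 + u <= expR u], the
   exponent becomes [u - ((1 + u)^2 - 1) / 2], which is exactly [- u^2 / 2]. *)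
apply: (@le_trans _ _ (expR u * expR (- ((sg ^+ 2 - 1) / 2)))).
  by rewrite ler_wpM2r ?expR_ge0// expR_ge1Dx.
rewrite -expRD ler_expR /sg; lra.
Qed.

End standard_normal_integrals.

(** * Conditioning on an independent variable *)

Section conditional_laws.
Context {R : realType} {d : measure_display} {T : measurableType d}.
Variable P : probability T R.
Context {d' : measure_display} {S : measurableType d'}.
Variables (Y : T -> S) (mY : measurable_fun setT Y).

(** Under independence the constant kernel equal to the law of [X] is a conditional law. *)
Lemma independent_cond_gaussian (n : nat) (X : T -> 'cV[R]_n) (m : 'cV[R]_n)
    (Sigma : 'M[R]_n) :
  independent P X Y -> gaussian_vector P X m Sigma ->
  cond_gaussian_vector P X Y m Sigma.
Proof.
move=> XY [mX gX].
pose RX : {mfun T >-> 'cV[R]_n} :=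
  HB.pack X (isMeasurableFun.Build _ _ _ _ X mX).
pose law : pprobability 'cV[R]_n R := distribution P RX.
have mlaw : measurable_fun setT (fun _ : S => law) by exact: measurable_cst.
exists (kprobability mlaw); last by move=> y; exact: gX.
move=> E mE; have mXE := preimage_measurable mX mE.
have PE : P (X @^-1` E) = (fine (P (X @^-1` E)))%:E.
  by rewrite fineK// fin_num_measure.
split.
- by change (measurable_fun setT (fun _ : S => P (X @^-1` E))); exact: measurable_cst.
- change (P.-integrable setT (fun _ : T => P (X @^-1` E))).
  by rewrite PE; exact: finite_measure_integrable_cst.
- move=> C mC; rewrite XY//.
  change (P (X @^-1` E) * P (Y @^-1` C) =
    \int[P]_(w in Y @^-1` C) (fun=> P (X @^-1` E)) w)%E.
  by rewrite PE -integral_cst//; exact: preimage_measurable.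
Qed.

(** Under the law of [Y], the version [h] and the constant [P A] have the same integral over every
    measurable set; the exceptional null set is then pulled back along [Y]. *)
Lemma independent_cond_prob_ae (A : set T) (h : S -> \bar R) :
  measurable A ->
  (forall C, measurable C -> P (A `&` Y @^-1` C) = (P A * P (Y @^-1` C))%E) ->
  is_cond_prob P Y A h -> {ae P, forall w, h (Y w) = P A}.
Proof.
move=> mA AY [mh ih PAh].
have PA : P A = (fine (P A))%:E by rewrite fineK// fin_num_measure.
pose nu := pushforward_measure P mY.
have : ae_eq nu setT h (fun=> P A).
  apply: integral_ae_eq => //.
    by apply: integrable_pushforward => //; rewrite preimage_setT.
  move=> C _ mC; have mYC := preimage_measurable mY mC.
  rewrite (integral_pushforward mY mh _ mC); last first.
    exact: (integrableS measurableT).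
  transitivity (P (A `&` Y @^-1` C)); first by rewrite PAh.
  by rewrite AY// PA integral_cst.
move=> [N [mN N0 hN]]; exists (Y @^-1` N); split => //.
  exact: preimage_measurable.
by move=> w hw; apply: hN => /= H; apply: hw; exact: H.
Qed.

Lemma emeasurable_prod (I : Type) (s : seq I) (h : I -> S -> \bar R) :
  (forall i, measurable_fun setT (h i)) ->
  measurable_fun setT (fun y => \prod_(i <- s) h i y)%E.
Proof.
move=> mh; elim: s => [|i s IHs].
  by under eq_fun do rewrite big_nil; exact: measurable_cst.
by under eq_fun do rewrite big_cons; exact: emeasurable_funM.
Qed.

Lemma independent_cond_mutually_independent (I : finType)
    (d1 : measure_display) (V : measurableType d1) (X : I -> T -> V) :
  (forall i, measurable_fun setT (X i)) ->
  (forall i, independent P (X i) Y) ->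
  (forall (E : I -> set V) (C : set S), (forall i, measurable (E i)) ->
    measurable C ->
    P (\bigcap_i X i @^-1` E i `&` Y @^-1` C) =
    ((\prod_i P (X i @^-1` E i)) * P (Y @^-1` C))%E) ->
  cond_mutually_independent P X Y.
Proof.
move=> mX XiY XY E h mE hcond.
have mXE i : measurable (X i @^-1` E i) by exact: preimage_measurable.
pose q := (\prod_i P (X i @^-1` E i))%E.
have qE : q = (fine q)%:E.
  rewrite fineK// /q; elim/big_ind : _ => // [x y|i _]; first exact: fin_numM.
  by apply: fin_num_measure; exact: mXE.
have hae : {ae P, forall w, (\prod_i h i (Y w))%E = q}.
  have : {ae P, forall w, forall i, h i (Y w) = P (X i @^-1` E i)}.
    apply: filter_forall => i; apply: independent_cond_prob_ae => // C mC.
    exact: XiY.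
  by apply: filterS => w hw; apply: eq_bigr => i _.
have mh : measurable_fun setT (fun y => \prod_i h i y)%E.
  by apply: emeasurable_prod => i; have [] := hcond i.
have mhY : measurable_fun setT (fun w => \prod_i h i (Y w))%E.
  exact: measurableT_comp mh mY.
split=> //.
- apply/integrableP; split=> //.
  rewrite (ae_eq_integral (fun=> `|q|)%E)//; last 2 first.
  + exact: measurableT_comp.
  + by apply: filterS hae => w hw _ /=; rewrite hw.
  by rewrite qE integral_cst//= probability_setT mule1 ltry.
- move=> C mC; have mYC := preimage_measurable mY mC.
  rewrite XY// (ae_eq_integral (fun=> q))//; last 2 first.
  + exact: measurable_funTS.
  + by apply: filterS hae => w hw _.
  by rewrite -/q qE integral_cst.
Qed.

End conditional_laws.

(** * Linear combinations of the blocks of a standard normal family *)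

Section gaussian_combinations.
Context {R : realType} {d : measure_display} {T : measurableType d}.
Variable P : probability T R.
Context {p n : nat}.
Local Notation B := ('I_p * 'I_n)%type.

(** The blocks of [g] are the vectors [g (i, _)]. A single noise vector and a difference of two are
    both of this form, so law, second moment and tail are established once. *)
Definition comb (alpha : 'I_p -> R) (g : {ffun B -> R}) : 'cV[R]_n :=
  \col_b \sum_i alpha i * g (i, b).

Lemma measurable_comb (alpha : 'I_p -> R) : measurable_fun setT (comb alpha).
Proof.
apply: measurable_fun_matrixP => b j.
have -> : (fun g => comb alpha g b j) = (fun g => \sum_i alpha i * g (i, b)).
  by apply/funext => g; rewrite mxE.
apply: measurable_sum => i; apply: measurable_funM => //.
exact: measurable_coordinate.
Qed.

(** The tensor product of [alpha] and [u], which represents the functional [u^T *m comb alpha g]. *)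
Definition comb_coef (alpha : 'I_p -> R) (u : 'cV[R]_n) : {ffun B -> R} :=
  [ffun ib => alpha ib.1 * u ib.2 0].

Lemma dot_comb_coef (alpha : 'I_p -> R) (u : 'cV[R]_n) (g : {ffun B -> R}) :
  dot (comb_coef alpha u) g = \sum_b u b 0 * comb alpha g b 0.
Proof.
rewrite /dot (eq_bigr (fun ib : B => u ib.2 0 * (alpha ib.1 * g (ib.1, ib.2)))).
  rewrite -(pair_bigA _ (fun i b => u b 0 * (alpha i * g (i, b)))) exchange_big/=.
  by apply: eq_bigr => b _; rewrite mxE mulr_sumr.
by move=> [i b] _; rewrite ffunE /=; ring.
Qed.

Lemma dot_comb_coefs (alpha : 'I_p -> R) (u v : 'cV[R]_n) :
  dot (comb_coef alpha u) (comb_coef alpha v) =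
  (\sum_i alpha i ^+ 2) * \sum_b u b 0 * v b 0.
Proof.
rewrite dot_comb_coef mulr_sumr; apply: eq_bigr => b _.
rewrite mxE mulr_suml mulr_sumr; apply: eq_bigr => i _; rewrite ffunE /=; ring.
Qed.

Variables (i0 : 'I_p) (b0 : 'I_n).

Lemma comb_gaussian (alpha : 'I_p -> R) (G : T -> {ffun B -> R}) :
  std_normal P G ->
  gaussian_vector P (fun w => comb alpha (G w)) 0 (\sum_i alpha i ^+ 2)%:M.
Proof.
move=> NG; have [mG _] := NG.
split; first exact: measurableT_comp (measurable_comb alpha) mG.
move=> u E mE; have -> : (u^T *m (\sum_i alpha i ^+ 2)%:M *m u) 0 0 =
    dot (comb_coef alpha u) (comb_coef alpha u).
  rewrite dot_comb_coefs mul_mx_scalar -scalemxAl mxE; congr (_ * _).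
  by rewrite mxE; apply: eq_bigr => b _; rewrite mxE.
rewrite mulmx0 mxE.
rewrite -(std_normal_dot_law (i0, b0) _ NG)// /pushforward; congr (P _).
suff uE w : (u^T *m comb alpha (G w)) 0 0 = dot (comb_coef alpha u) (G w).
  by apply/seteqP; split => w /=; rewrite uE.
by rewrite dot_comb_coef mxE; apply: eq_bigr => b _; rewrite [u^T _ _]mxE.
Qed.

Lemma comb_norm2_sqr (alpha : 'I_p -> R) (G : T -> {ffun B -> R}) :
  std_normal P G ->
  ('E_P[fun w => (norm2 (comb alpha (G w)) ^+ 2)%R] =
   (n%:R * \sum_i alpha i ^+ 2)%:E)%E.
Proof.
move=> NG; have [mG _] := NG; rewrite unlock.
pose u b : 'cV[R]_n := \col_k (k == b)%:R.
have ub b w : comb alpha (G w) b 0 = dot (comb_coef alpha (u b)) (G w).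
  rewrite dot_comb_coef (bigD1 b)//= [u b b 0]mxE eqxx mul1r big1 ?addr0//.
  by move=> j jb; rewrite [u b j 0]mxE (negbTE jb) mul0r.
transitivity (\int[P]_w \sum_b ((dot (comb_coef alpha (u b)) (G w)) ^+ 2)%:E)%E.
  apply: eq_integral => w _; rewrite sqr_sqrtr; last first.
    by apply: sumr_ge0 => b _; exact: sqr_ge0.
  by rewrite -sumEFin; apply: eq_bigr => b _; rewrite ub.
rewrite ge0_integral_sum//; last 2 first.
- move=> b; apply/measurable_EFinP; apply: measurable_funX.
  exact: measurableT_comp (measurable_dot _) mG.
- by move=> b w _; rewrite lee_fin sqr_ge0.
under eq_bigr do rewrite (std_normal_dot_sqr (i0, b0) _ NG).
rewrite sumEFin; congr EFin.
rewrite (eq_bigr (fun=> \sum_i alpha i ^+ 2)).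
  by rewrite sumr_const card_ord mulr_natl.
move=> b _; rewrite dot_comb_coefs [X in _ * X](bigD1 b)//=.
rewrite [X in _ * (_ + X)]big1 => [|j jb].
  by rewrite [u b b 0]mxE eqxx mulr1 addr0 mulr1.
by rewrite [u b j 0]mxE (negbTE jb) mul0r.
Qed.

(** With [k] the sum of the squares of [alpha], the coordinates of [comb alpha] divided by [sqrt k]
    form a standard normal family of size [n]. If [k = 0] the combination vanishes. *)
Lemma comb_norm2_tail (alpha : 'I_p -> R) (G : T -> {ffun B -> R}) (t : R) :
  0 <= t -> std_normal P G ->
  ((1 - expR (- (t ^+ 2 / 2)))%:E <=
   P [set w | (norm2 (comb alpha (G w)) <=
     Num.sqrt (\sum_i alpha i ^+ 2) * (Num.sqrt n%:R + t))%R])%E.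
Proof.
move=> t0 NG; set k := \sum_i _.
have k0 : 0 <= k by apply: sumr_ge0 => i _; exact: sqr_ge0.
have [kz|kn0] := eqVneq k 0.
  have al0 i : alpha i = 0.
    apply/eqP; rewrite -sqrf_eq0; move/eqP : kz.
    rewrite psumr_eq0 => [/allP/(_ i (mem_index_enum _))//|j _]; exact: sqr_ge0.
  rewrite (_ : [set _ | _] = setT) ?probability_setT ?lee_fin.
    by rewrite gerBl// expR_ge0.
  apply/seteqP; split => // w _ /=; rewrite kz sqrtr0 mul0r.
  rewrite /norm2 big1 ?sqrtr0// => b _; rewrite mxE big1 ?expr0n// => i _.
  by rewrite al0 mul0r.
have kp : 0 < k by rewrite lt_neqAle eq_sym kn0.
have sk : 0 < Num.sqrt k by rewrite sqrtr_gt0.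
pose u b : 'cV[R]_n := \col_j ((j == b)%:R / Num.sqrt k).
pose c b := comb_coef alpha (u b).
have dotc b g : dot (c b) g = comb alpha g b 0 / Num.sqrt k.
  rewrite dot_comb_coef (bigD1 b)//= big1 ?addr0 => [|j jb].
    by rewrite [u b b 0]mxE eqxx mul1r mulrC.
  by rewrite [u b j 0]mxE (negbTE jb) !mul0r.
have oc : orthonormal_family c.
  move=> b b'; rewrite dot_comb_coefs -/k [X in _ * X](bigD1 b)//=.
  rewrite [X in _ * (_ + X)]big1 => [|j jb].
    rewrite addr0 [u b b 0]mxE [u b' b 0]mxE eqxx mul1r.
    rewrite [(Num.sqrt k)^-1 * _]mulrCA -invfM -expr2 sqr_sqrtr//.
    by rewrite mulrCA divff// mulr1.
  by rewrite [u b j 0]mxE (negbTE jb) !mul0r.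
have injb : injective (fun b : 'I_n => (i0, b)) by move=> b b' [].
have NY := std_normal_orthonormal injb oc NG.
have := std_normal_norm_tail _ t0 NY; rewrite card_ord => /(_ _)/le_trans; apply.
  by case: (n) b0 => [[]|].
rewrite le_eqVlt; apply/orP; left; apply/eqP; congr (P _); apply/seteqP.
suff E w : norm2 (comb alpha (G w)) = Num.sqrt k *
    Num.sqrt (dot [ffun b => dot (c b) (G w)] [ffun b => dot (c b) (G w)]).
  by split => w /=; rewrite E ler_pM2l.
rewrite -sqrtrM// /norm2; congr Num.sqrt; rewrite mulr_sumr.
apply: eq_bigr => b _; rewrite ffunE dotc -expr2 expr_div_n sqr_sqrtr//.
by rewrite mulrC divfK.
Qed.

End gaussian_combinations.

(** * Means, deviations and rotated noise *)

Section translation_noise.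
Context {R : realType} {p d r : nat}.
Local Notation I := ('I_p * ('I_r * 'I_d))%type.
Local Notation B := ('I_p * 'I_d)%type.

Definition entries (M : 'I_p -> 'M[R]_(r, d)) : {ffun I -> R} :=
  [ffun k => M k.1 k.2.1 k.2.2].

(** Means and deviations are both inner products with coefficients [alpha] placed in a single column
    of a single matrix. *)
Definition column_vector (i : 'I_p) (b : 'I_d) (alpha : 'I_r -> R) :
  {ffun I -> R} := [ffun k => (k.1 == i)%:R * ((k.2.2 == b)%:R * alpha k.2.1)].

Lemma dot_column_vector (i : 'I_p) (b : 'I_d) (alpha : 'I_r -> R)
    (x : {ffun I -> R}) :
  dot (column_vector i b alpha) x = \sum_a alpha a * x (i, (a, b)).
Proof.
rewrite /dot (eq_bigr (fun k : I =>
  (k.1 == i)%:R * ((k.2.2 == b)%:R * alpha k.2.1 * x (k.1, (k.2.1, k.2.2))))).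
  rewrite -(pair_bigA _ (fun i' (ab : 'I_r * 'I_d) =>
    (i' == i)%:R * ((ab.2 == b)%:R * alpha ab.1 * x (i', (ab.1, ab.2))))).
  rewrite /= (bigD1 i)//= [X in _ + X]big1 ?addr0 => [|i' ii'].
    rewrite -(pair_bigA _ (fun a b' =>
      (i == i)%:R * ((b' == b)%:R * alpha a * x (i, (a, b'))))) /=.
    apply: eq_bigr => a _; rewrite (bigD1 b)//= [X in _ + X]big1 ?addr0 => [|b' bb'].
      by rewrite !eqxx !mul1r.
    by rewrite (negbTE bb') !mul0r mulr0.
  by rewrite big1 // => ab _; rewrite (negbTE ii') mul0r.
by move=> [i' [a b']] _; rewrite ffunE /= !mulrA.
Qed.

Definition mean_vector (ib : B) : {ffun I -> R} :=
  column_vector ib.1 ib.2 (fun=> (Num.sqrt r%:R)^-1).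

(** A row of the centering matrix placed in a column of a block; pairing it with the noise entries
    gives an entry of the centered noise matrix. *)
Definition deviation_vector (k : I) : {ffun I -> R} :=
  column_vector k.1 k.2.2 (fun a => (a == k.2.1)%:R - r%:R^-1).

Lemma mean_vector_orthonormal : (0 < r)%N -> orthonormal_family mean_vector.
Proof.
move=> r0 [i b] [i' b']; rewrite dot_column_vector /=.
under eq_bigr do rewrite ffunE /=.
have -> : ((i, b) == (i', b')) = (i == i') && (b == b') by [].
rewrite sumr_const card_ord; case: (i == i'); case: (b == b') => /=;
  rewrite ?mul0r ?mulr0 ?mul1r ?mul0rn//.
rewrite -invfM -expr2 sqr_sqrtr// -[LHS]mulr_natl divff//.
by rewrite pnatr_eq0 -lt0n.
Qed.

(** Mean vectors are constant along a column, and each row of the centering matrix sums to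
    [1 - r * r^-1 = 0]. *)
Lemma deviation_vector_orthogonal (k : I) (ib : B) : (0 < r)%N ->
  dot (deviation_vector k) (mean_vector ib) = 0.
Proof.
move=> r0; rewrite dotC dot_column_vector /=.
under eq_bigr do rewrite ffunE /=.
have c1 : \sum_(a < r) (r%:R^-1 : R) = 1.
  by rewrite sumr_const card_ord -[LHS]mulr_natl divff// pnatr_eq0 -lt0n.
rewrite -!mulr_sumr sumrB c1 (bigD1 k.2.1)//= eqxx big1 => [|a ak].
  by rewrite addr0 subrr !mulr0.
by rewrite (negbTE ak).
Qed.

Lemma translation_noise_entries (v : R) (M : 'I_p -> 'M[R]_(r, d)) (i : 'I_p)
    (b : 'I_d) : (0 < r)%N ->
  translation_noise v (M i) b 0 =
  v / Num.sqrt r%:R * dot (mean_vector (i, b)) (entries M).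
Proof.
move=> r0; rewrite !mxE dot_column_vector -mulr_sumr mulrA; congr (_ * _).
  rewrite -mulrA -invfM -expr2 sqr_sqrtr//.
by apply: eq_bigr => a _; rewrite !mxE ffunE mulr1.
Qed.

(** The columns of [A] sum to zero, so centering leaves [A *m O] unchanged; the translation is
    constant along columns and is removed. *)
Lemma centered_anchor (A : 'M[R]_(r, d)) (v : R) (O : 'M[R]_d) (Psi : 'cV[R]_d)
    (M : 'I_p -> 'M[R]_(r, d)) (i : 'I_p) : (0 < r)%N -> (ones r)^T *m A = 0 ->
  centered (anchor A v O Psi (M i)) =
  A *m O + v *: \matrix_(a, b) dot (deviation_vector (i, (a, b))) (entries M).
Proof.
move=> r0 A1.
have rn0 : r%:R != 0 :> R by rewrite pnatr_eq0 -lt0n.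
have onesE : (ones r)^T *m ones r = r%:R%:M :> 'M[R]_1.
  apply/matrixP => i0 j0; rewrite !mxE !ord1 eqxx.
  under eq_bigr do rewrite !mxE mulr1.
  by rewrite sumr_const card_ord.
have X1 : (ones r)^T *m anchor A v O Psi (M i) =
    r%:R *: Psi^T + v *: ((ones r)^T *m M i).
  rewrite /anchor !mulmxDr !mulmxA A1 mul0mx add0r onesE mul_scalar_mx.
  by rewrite -scalemxAr.
rewrite /centered mulmxBl mul1mx -scalemxAl -mulmxA X1 mulmxDr -!scalemxAr.
rewrite scalerDr scalerA mulVf// scale1r /anchor opprD addrA.
rewrite [X in X - _]addrAC addrK -addrA; congr (_ + _).
rewrite scalerA [_ * v]mulrC -scalerA -scalerBr; congr (v *: _).
apply/matrixP => a b; rewrite !mxE dot_column_vector /=.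
under [in RHS]eq_bigr do rewrite ffunE mulrBl /=.
rewrite sumrB [in RHS](bigD1 a)//= eqxx mul1r.
rewrite [X in _ = _ + X - _]big1 ?addr0 => [|a' aa']; last first.
  by rewrite (negbTE aa') mul0r.
congr (_ - _); rewrite big_ord1 !mxE mul1r mulr_sumr.
by apply: eq_bigr => a' _; rewrite !mxE mul1r.
Qed.

End translation_noise.

Section rotated_noise.
Context {R : realType} {dsp : measure_display} {T : measurableType dsp}.
Variable P : probability T R.
Context {p d : nat}.
Local Notation B := ('I_p * 'I_d)%type.

(** Block [i] is multiplied by the transpose of the [i]-th matrix, hence the index order
    [k ib.2]. *)
Definition rotate_noise (t : p.-tuple 'M[R]_d) (g : {ffun B -> R}) :
  {ffun B -> R} :=
  [ffun ib => \sum_k tnth t ib.1 k ib.2 * g (ib.1, k)].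

Lemma measurable_rotate_noise :
  measurable_fun setT (fun z : {ffun B -> R} * p.-tuple 'M[R]_d =>
    rotate_noise z.2 z.1).
Proof.
apply: measurable_fun_ffunP => ib.
have -> : (fun z : {ffun B -> R} * p.-tuple 'M[R]_d => rotate_noise z.2 z.1 ib) =
    (fun z => \sum_k tnth z.2 ib.1 k ib.2 * z.1 (ib.1, k)).
  by apply/funext => z; rewrite ffunE.
apply: measurable_sum => k; apply: measurable_funM.
  apply: measurableT_comp (measurable_entry k ib.2) _.
  exact: measurableT_comp (measurable_tnth ib.1) measurable_snd.
exact: measurableT_comp (measurable_coordinate (ib.1, k)) measurable_fst.
Qed.

Lemma std_normal_rotate_noise (t : p.-tuple 'M[R]_d) (G : T -> {ffun B -> R}) :
  (forall i, orthogonal_mx (tnth t i)) -> std_normal P G ->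
  std_normal P (fun w => rotate_noise t (G w)).
Proof.
move=> ot NG.
(* Column [ib.2] of the matrix with index [ib.1], placed in that block; orthogonality of the
   matrices makes this an orthonormal family. *)
pose c (ib : B) : {ffun B -> R} :=
  [ffun jk => (jk.1 == ib.1)%:R * tnth t ib.1 jk.2 ib.2].
have dotc ib g : dot (c ib) g = \sum_k tnth t ib.1 k ib.2 * g (ib.1, k).
  rewrite /dot (eq_bigr (fun jk : B =>
    (jk.1 == ib.1)%:R * tnth t ib.1 jk.2 ib.2 * g (jk.1, jk.2))).
    rewrite -(pair_bigA _ (fun j k =>
      (j == ib.1)%:R * tnth t ib.1 k ib.2 * g (j, k))) /=.
    rewrite (bigD1 ib.1)//= [X in _ + X]big1 ?addr0 => [|j ji].
      by apply: eq_bigr => k _; rewrite eqxx mul1r.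
    by rewrite big1// => k _; rewrite (negbTE ji) !mul0r.
  by move=> [j k] _; rewrite ffunE.
have oc : orthonormal_family c.
  move=> [i b] [i' b']; rewrite dotc /=.
  have -> : ((i, b) == (i', b')) = (i == i') && (b == b') by [].
  under eq_bigr do rewrite ffunE /=.
  have [<-|ii'] := eqVneq i i'; last by rewrite big1// => k _; rewrite mul0r mulr0.
  have /matrixP/(_ b b') := ot i; rewrite !mxE => <-.
  by apply: eq_bigr => k _; rewrite !mxE mul1r.
have := std_normal_orthonormal (@inj_id B) oc NG; congr (std_normal P _).
by apply/funext => w; apply/ffunP => ib; rewrite !ffunE dotc.
Qed.

(** For each frozen value of [Q] the matrices are orthogonal, so the rotated noise has the law of
    [G]. Testing it jointly with [C] yields both its law and its independence from [Q]. *)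
Lemma rotate_noise_independent (Q : T -> p.-tuple 'M[R]_d)
    (G : T -> {ffun B -> R}) (E : set {ffun B -> R}) (C : set (p.-tuple 'M[R]_d)) :
  measurable_fun setT Q -> (forall w i, orthogonal_mx (tnth (Q w) i)) ->
  std_normal P G -> independent P G Q -> measurable E -> measurable C ->
  P [set w | E (rotate_noise (Q w) (G w)) /\ C (Q w)] =
  (P (G @^-1` E) * P (Q @^-1` C))%E.
Proof.
move=> mQ oQ NG GQ mE mC; have [mG _] := NG.
pose D : set ({ffun B -> R} * p.-tuple 'M[R]_d) :=
  [set z | E (rotate_noise z.2 z.1) /\ C z.2].
have mD : measurable D.
  apply: measurableI.
    exact: (preimage_measurable measurable_rotate_noise mE).
  exact: (preimage_measurable measurable_snd mC).
have mQC := preimage_measurable mQ mC.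
have PG : P (G @^-1` E) = (fine (P (G @^-1` E)))%:E.
  by rewrite fineK// fin_num_measure//; exact: preimage_measurable.
have := independent_section mG mQ GQ mD; rewrite /D /= => ->.
transitivity (\int[P]_w (P (G @^-1` E) * (\1_(Q @^-1` C) w : R)%:E))%E.
  apply: eq_integral => w _; rewrite indicE.
  have [Cw|Cw] := boolP (w \in Q @^-1` C); rewrite ?mule1 ?mule0.
    rewrite -(std_normal_law (std_normal_rotate_noise (oQ w) NG) NG mE).
    congr (P _); apply/seteqP; split => w' /=; first by case.
    by split => //; move: Cw; rewrite inE.
  rewrite (_ : [set _ | _] = set0) ?measure0//.
  apply/seteqP; split => // w' /= [_ Cw']; move/negP: Cw; apply.
  by rewrite inE.
rewrite PG ge0_integralZl//; last 2 first.
- by apply/measurable_EFinP; exact: measurable_indic.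
- by rewrite -PG.
by rewrite integral_indic; [rewrite setIT|exact: measurableT|exact: mQC].
Qed.

End rotated_noise.

(** On a rectangle, independence of [U] and [V] splits off [V], and then the two functions of [U]
    separate. It is meant for [U] the noise matrices, [V] the parameters, [g] the means and [h] the
    deviations. *)
Lemma independent_pair {R : realType} {d : measure_display}
    {T : measurableType d} (P : probability T R)
    {d1 d2 d3 d4 : measure_display} {V1 : measurableType d1}
    {V2 : measurableType d2} {V3 : measurableType d3} {V4 : measurableType d4}
    (U : T -> V1) (V : T -> V2) (g : V1 -> V3) (h : V1 -> V4) :
  measurable_fun setT U -> measurable_fun setT V ->
  measurable_fun setT g -> measurable_fun setT h ->
  independent P U V -> independent P (g \o U) (h \o U) ->
  independent P (g \o U) (fun w => (h (U w), V w)).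
Proof.
move=> mU mV mg mh UV gh E F mE mF; rewrite setIC muleC.
have mgU := measurableT_comp mg mU; have mhU := measurableT_comp mh mU.
have mgE := preimage_measurable mg mE.
have mEU := preimage_measurable mgU mE.
pose rect : set (set (V4 * V2)) :=
  [set A `*` B | A in measurable & B in measurable].
have rectI : setI_closed rect.
  move=> _ _ [A mA [B mB <-]] [A' mA' [B' mB' <-]]; rewrite -setXI.
  exists (A `&` A'); first exact: measurableI.
  by exists (B `&` B') => //; exact: measurableI.
have rectT : rect setT.
  by exists setT => //; exists setT => //; rewrite setXTT.
apply: (pi_system_indep (measurable_prod_measurableType _ _) rectI rectT) => //.
  exact: measurable_fun_pair.
move=> _ [A mA [B mB <-]].
have mhA := preimage_measurable mh mA.
have -> : (fun w => (h (U w), V w)) @^-1` (A `*` B) =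
    U @^-1` (h @^-1` A) `&` V @^-1` B by [].
rewrite (UV _ _ mhA mB).
have -> : U @^-1` (h @^-1` A) `&` V @^-1` B `&` (g \o U) @^-1` E =
    U @^-1` (g @^-1` E `&` h @^-1` A) `&` V @^-1` B.
  by apply/seteqP; split => w /=; tauto.
rewrite UV//; last exact: measurableI.
have -> : P (U @^-1` (g @^-1` E `&` h @^-1` A)) =
    (P ((g \o U) @^-1` E) * P ((h \o U) @^-1` A))%E.
  by rewrite preimage_setI; exact: gh.
by rewrite -muleA muleC.
Qed.

Lemma joint_measurable {d d' : measure_display} {T : measurableType d}
    {V : measurableType d'} {p : nat} (X : 'I_p -> T -> V) :
  (forall i, measurable_fun setT (X i)) -> measurable_fun setT (joint X).
Proof.
move=> mX; apply/measurable_fun_tnthP => i.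
rewrite (_ : _ \o _ = X i)//; apply/funext => w /=.
by rewrite /joint tnth_mktuple.
Qed.

(** * The entries of all noise matrices as one standard normal family *)

Section gaussian_entries.
Context {R : realType} {disp : measure_display} {T : measurableType disp}.
Variable P : probability T R.
Context {p d r : nat}.
Local Notation I := ('I_p * ('I_r * 'I_d))%type.

Lemma measurable_entries :
  measurable_fun setT (fun t : p.-tuple 'M[R]_(r, d) => entries (tnth t)).
Proof.
apply: measurable_fun_ffunP => k.
have -> : (fun t : p.-tuple 'M[R]_(r, d) => entries (tnth t) k) =
    (fun t => tnth t k.1 k.2.1 k.2.2) by apply/funext => t; rewrite ffunE.
exact: measurableT_comp (measurable_entry _ _) (measurable_tnth k.1).
Qed.

(** A box in all entries is an intersection over [i] of boxes [F i] of matrices; independence across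
    the matrices and then within each one factors its probability. *)
Lemma entries_std_normal (W : 'I_p -> T -> 'M[R]_(r, d)) :
  (forall i, measurable_fun setT (W i)) ->
  (forall i a b (E : set R), measurable E ->
    P [set w | E (W i w a b)] = normal_prob 0 1 E) ->
  (forall i, mutually_independent P
    (fun (ab : 'I_r * 'I_d) w => W i w ab.1 ab.2)) ->
  mutually_independent P W ->
  std_normal P (fun w => entries (fun i => W i w)).
Proof.
move=> mW WN Wab Wi; split.
  apply: measurable_fun_ffunP => k.
  have -> : (fun w => entries (fun i => W i w) k) =
      (fun w => W k.1 w k.2.1 k.2.2) by apply/funext => w; rewrite ffunE.
  exact: measurableT_comp (measurable_entry _ _) (mW k.1).
move=> E mE.
pose F (i : 'I_p) : set 'M[R]_(r, d) :=
  \bigcap_(ab in [set: 'I_r * 'I_d])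
    (fun M : 'M[R]_(r, d) => M ab.1 ab.2) @^-1` E (i, ab).
have mF i : measurable (F i).
  apply: fin_bigcap_measurable; first exact: finite_finset.
  by move=> ab _; apply: preimage_measurable => //; exact: measurable_entry.
have -> : (fun w => entries (fun i => W i w)) @^-1` box E =
    \bigcap_(i in [set` [set: 'I_p]%SET]) W i @^-1` F i.
  apply/seteqP; split => w /=.
    by move=> Ew i _ ab _ /=; have := Ew (i, ab); rewrite ffunE.
  move=> Fw [i ab]; rewrite ffunE /=; apply: (Fw i _ ab) => //=.
  by rewrite finset.in_setT.
rewrite Wi//.
rewrite (eq_bigr (fun i => \prod_(ab : 'I_r * 'I_d) normal_prob 0 1 (E (i, ab)))%E).
  rewrite (eq_bigl predT) => [|i]; last by rewrite finset.in_setT.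
  by rewrite pair_bigA/=; apply: eq_bigr => -[i ab].
move=> i _.
have -> : W i @^-1` F i = \bigcap_(ab in [set` [set: 'I_r * 'I_d]%SET])
    (fun w => W i w ab.1 ab.2) @^-1` E (i, ab).
  apply/seteqP; split => w /= Fw ab _; apply: Fw => //=.
  by rewrite finset.in_setT.
rewrite (Wab i [set: 'I_r * 'I_d]%SET (fun ab => E (i, ab)))//.
rewrite (eq_bigl predT) => [|ab]; last by rewrite finset.in_setT.
by apply: eq_bigr => ab _; exact: WN.
Qed.

End gaussian_entries.

Section selection.
Context {R : realType} {p : nat}.

Definition selection (s : R) (i j : 'I_p) : R := (j == i)%:R * s.

Lemma comb_selection (n : nat) (s : R) (i : 'I_p) (g : {ffun 'I_p * 'I_n -> R})
    (b : 'I_n) : comb (selection s i) g b 0 = s * g (i, b).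
Proof.
rewrite mxE (bigD1 i)//= big1 ?addr0 => [|j ji].
  by rewrite /selection eqxx mul1r.
by rewrite /selection (negbTE ji) !mul0r.
Qed.

Lemma sum_selection_sqr (s : R) (i : 'I_p) :
  \sum_j selection s i j ^+ 2 = s ^+ 2.
Proof.
rewrite (bigD1 i)//= big1 ?addr0 => [|j ji].
  by rewrite /selection eqxx mul1r.
by rewrite /selection (negbTE ji) mul0r expr0n.
Qed.

(** The two coefficient vectors have disjoint supports, which is the origin of the factor 2 in the
    variance of a difference. *)
Lemma sum_selectionB_sqr (s : R) (i i' : 'I_p) : i != i' ->
  \sum_j (selection s i j - selection s i' j) ^+ 2 = 2 * s ^+ 2.
Proof.
move=> ii'; have i'i : i' != i by rewrite eq_sym.
rewrite (bigD1 i)//= (bigD1 i')//= big1 => [|j /andP[ji ji']].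
  by rewrite /selection !eqxx (negbTE ii') (negbTE i'i) mul1r mul0r subr0
    sub0r sqrrN addr0 -mulr2n mulr_natl.
by rewrite /selection (negbTE ji) (negbTE ji') !mul0r subr0 expr0n.
Qed.

Lemma combB (n : nat) (alpha beta : 'I_p -> R) (g : {ffun 'I_p * 'I_n -> R}) :
  comb alpha g - comb beta g = comb (fun i => alpha i - beta i) g.
Proof.
apply/matrixP => b j; rewrite !mxE -sumrB.
by apply: eq_bigr => i _; rewrite mulrBl.
Qed.

End selection.

Theorem proposition4p5 (R : realType) (disp : measure_display)
  (T : measurableType disp) (P : probability T R)
  (p d r : nat) (hp : (2 <= p)%N) (hd : (1 <= d)%N) (hr : (d + 1 <= r)%N)
  (v : R) (hv : 0 <= v)
  (A : 'M[R]_(r, d))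
  (hA1 : (ones r)^T *m A = 0) (hAA : A^T *m A = 1%:M)
  (O : 'I_p -> {RV P >-> 'M[R]_d}) (Psi : 'I_p -> {RV P >-> 'cV[R]_d})
  (W : 'I_p -> {RV P >-> 'M[R]_(r, d)})
  (hO : forall i w, orthogonal_mx (O i w))
  (hWnormal : forall i a b (E : set R), measurable E ->
    P [set w | E (W i w a b)] = normal_prob 0 1 E)
  (hWentries : forall i, mutually_independent P
    (fun (ab : 'I_r * 'I_d) w => W i w ab.1 ab.2))
  (hWindep : mutually_independent P (fun i => W i : T -> 'M[R]_(r, d)))
  (hWparam : independent P (joint (fun i => W i : T -> 'M[R]_(r, d)))
    (joint (fun i w => (O i w, Psi i w))))
  (Rhat : 'I_p -> T -> 'M[R]_d)
  (hRhat : forall i w, orthogonal_mx (Rhat i w))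
  (hcomputed : computed_from (joint Rhat)
    (joint (fun i w => centered (anchor A v (O i w) (Psi i w) (W i w))))) :
  let eta (i : 'I_p) (w : T) : 'cV[R]_d := translation_noise v (W i w) in
  let Z (i : 'I_p) (w : T) : 'cV[R]_d := (Rhat i w)^T *m eta i w in
  [/\ forall i, gaussian_vector P (eta i) 0 (v ^+ 2 / r%:R)%:M,
      independent P (joint eta) (joint Rhat),
      cond_mutually_independent P Z (joint Rhat),
      forall i, cond_gaussian_vector P (Z i) (joint Rhat) 0
        (v ^+ 2 / r%:R)%:M &
      forall i j, i != j ->
        [/\ gaussian_vector P (fun w => Z i w - Z j w) 0
              (2 * v ^+ 2 / r%:R)%:M,
            ('E_P[fun w => (norm2 (Z i w - Z j w) ^+ 2)%R])%E =
              (2 * d%:R * v ^+ 2 / r%:R)%:E &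
            forall zeta : R, 0 < zeta < 1 ->
              ((1 - zeta)%:E <=
               P [set w | (norm2 (Z i w - Z j w) <=
                 Num.sqrt 2 * v / Num.sqrt r%:R *
                   (Num.sqrt d%:R + Num.sqrt (2 * ln (1 / zeta))))%R])%E]].
Proof.
move=> eta Z.
have p0 : (0 < p)%N by exact: leq_trans hp.
have r0 : (0 < r)%N by apply: leq_trans hr; rewrite addn1.
pose i0 : 'I_p := Ordinal p0; pose b0 : 'I_d := Ordinal hd.
pose a0 : 'I_r := Ordinal r0.
have rn0 : 0 <= r%:R :> R by [].
(* The standard deviation of one noise coordinate: [eta i] is [s] times block [i] of the normalised
   means [G]. *)
pose s := v / Num.sqrt r%:R.
have s2 : s ^+ 2 = v ^+ 2 / r%:R by rewrite expr_div_n sqr_sqrtr.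
have s0 : 0 <= s by rewrite divr_ge0// sqrtr_ge0.
have mW i : measurable_fun setT (W i : T -> 'M[R]_(r, d)) by [].
pose X w := entries (fun i => W i w).
have NX : std_normal P X by exact: entries_std_normal.
have [mX _] := NX.
(* Each mean vector is to be moved onto the entry of its column in row [a0]. *)
have injf : injective (fun ib : 'I_p * 'I_d => (ib.1, (a0, ib.2))).
  by move=> [i b] [i' b'] [-> ->].
have om := @mean_vector_orthonormal R p d r r0.
pose means (x : {ffun 'I_p * ('I_r * 'I_d) -> R}) : {ffun 'I_p * 'I_d -> R} :=
  [ffun ib => dot (mean_vector ib) x].
pose devs (x : {ffun 'I_p * ('I_r * 'I_d) -> R}) :
    {ffun 'I_p * ('I_r * 'I_d) -> R} := [ffun k => dot (deviation_vector k) x].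
have mmeans : measurable_fun setT means.
  apply: measurable_fun_ffunP => ib.
  have -> : (fun x => means x ib) = dot (mean_vector ib).
    by apply/funext => x; rewrite ffunE.
  exact: measurable_dot.
have mdevs : measurable_fun setT devs.
  apply: measurable_fun_ffunP => k.
  have -> : (fun x => devs x k) = dot (deviation_vector k).
    by apply/funext => x; rewrite ffunE.
  exact: measurable_dot.
pose G w := means (X w).
have NG : std_normal P G by exact: std_normal_orthonormal injf om NX.
have [mG _] := NG.
have GD : independent P (means \o X) (devs \o X).
  apply: std_normal_orthogonal_independent injf om _ NX => k ib.
  exact: deviation_vector_orthogonal.
pose Wj := joint (fun i => W i : T -> 'M[R]_(r, d)).
pose par := joint (fun i w => (O i w, Psi i w)).
have mWj : measurable_fun setT Wj by exact: joint_measurable.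
have mpar : measurable_fun setT par.
  by apply: joint_measurable => i; exact: measurable_fun_pair.
pose ent (t : p.-tuple 'M[R]_(r, d)) := entries (tnth t).
have ment : measurable_fun setT ent by exact: measurable_entries.
have entW w : ent (Wj w) = X w.
  by apply/ffunP => k; rewrite !ffunE /Wj /joint tnth_mktuple.
have GDp : independent P G (fun w => (devs (X w), par w)).
  have := @independent_pair _ _ _ P _ _ _ _ _ _ _ _ Wj par (means \o ent)
    (devs \o ent) mWj mpar (measurableT_comp mmeans ment)
    (measurableT_comp mdevs ment) hWparam.
  have -> : (means \o ent) \o Wj = G by apply/funext => w /=; rewrite entW.
  have -> : (devs \o ent) \o Wj = devs \o X.
    by apply/funext => w /=; rewrite entW.
  have -> : (fun w => ((devs \o ent) (Wj w), par w)) =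
      (fun w => (devs (X w), par w)) by apply/funext => w /=; rewrite entW.
  by apply.
have [rho mrho rhoE] := hcomputed.
pose Q := joint Rhat.
pose data : Type :=
  ({ffun 'I_p * ('I_r * 'I_d) -> R} * p.-tuple ('M[R]_d * 'cV[R]_d))%type.
(* The centered anchors as a measurable function of deviations and parameters, through which [Q]
   factors. *)
pose cen (z : {ffun 'I_p * ('I_r * 'I_d) -> R} * p.-tuple ('M[R]_d * 'cV[R]_d)) :=
  joint (fun i (z : data) => A *m (tnth z.2 i).1 +
    v *: \matrix_(a, b) z.1 (i, (a, b))) z.
have mcen : measurable_fun setT cen.
  apply: joint_measurable => i; apply: measurable_fun_matrixP => a b.
  have -> : (fun z : {ffun 'I_p * ('I_r * 'I_d) -> R} *
        p.-tuple ('M[R]_d * 'cV[R]_d) =>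
      (A *m (tnth z.2 i).1 + v *: \matrix_(a, b) z.1 (i, (a, b))) a b) =
      (fun z => \sum_k A a k * (tnth z.2 i).1 k b + v * z.1 (i, (a, b))).
    by apply/funext => z; rewrite !mxE.
  apply: measurable_funD.
    apply: measurable_sum => k; apply: measurable_funM => //.
    apply: measurableT_comp (measurable_entry k b) _.
    apply: measurableT_comp measurable_fst _.
    exact: measurableT_comp (measurable_tnth i) measurable_snd.
  apply: measurable_funM => //.
  exact: measurableT_comp (measurable_coordinate _) measurable_fst.
have QE : Q = (rho \o cen) \o (fun w => (devs (X w), par w)).
  apply/funext => w /=; rewrite /Q rhoE; congr (rho _).
  apply: eq_from_tnth => i; rewrite /cen /joint !tnth_mktuple.
  rewrite (centered_anchor v (O i w) (Psi i w) (fun i => W i w) i r0 hA1).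
  congr (_ + _ *: _).
  by apply/matrixP => a b; rewrite !mxE ffunE.
have mQ : measurable_fun setT Q.
  rewrite QE; apply: measurableT_comp; first exact: measurableT_comp.
  by apply: measurable_fun_pair => //; exact: measurableT_comp.
have GQ : independent P G Q.
  rewrite QE; exact: (independent_comp (@measurable_id _ _ setT)
    (measurableT_comp mrho mcen) GDp).
have oQ w i : orthogonal_mx (tnth (Q w) i).
  by rewrite /Q /joint tnth_mktuple; exact: hRhat.
pose G' w := rotate_noise (Q w) (G w).
have mG' : measurable_fun setT G'.
  exact: (measurableT_comp measurable_rotate_noise (measurable_fun_pair mG mQ)).
have G'Q E C : measurable E -> measurable C ->
    P (G' @^-1` E `&` Q @^-1` C) = (P (G @^-1` E) * P (Q @^-1` C))%E.
  by move=> mE mC; exact: rotate_noise_independent.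
(* Taking [C = setT] in [G'Q] isolates the law of the rotated noise. *)
have G'G E : measurable E -> P (G' @^-1` E) = P (G @^-1` E).
  move=> mE; have := G'Q E setT mE measurableT.
  by rewrite preimage_setT setIT probability_setT mule1.
have NG' : std_normal P G'.
  split=> // E mE; rewrite G'G; last exact: measurable_box.
  by case: NG => _; exact.
have G'Qi : independent P G' Q by move=> E C mE mC; rewrite G'Q// G'G.
have etaE i w : eta i w = comb (selection s i) (G w).
  apply/matrixP => b j; rewrite ord1 comb_selection ffunE.
  exact: (translation_noise_entries v (fun i => W i w) i b r0).
have ZE i w : Z i w = comb (selection s i) (G' w).
  apply/matrixP => b j; rewrite ord1 comb_selection ffunE /Z etaE mxE mulr_sumr.
  apply: eq_bigr => k _; rewrite comb_selection mxE /Q /joint tnth_mktuple /=.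
  by rewrite mulrCA.
have etaF i : eta i = comb (selection s i) \o G by apply/funext => w; exact: etaE.
have ZF i : Z i = comb (selection s i) \o G' by apply/funext => w; exact: ZE.
have mcomb i : measurable_fun setT (@comb R p d (selection s i)).
  exact: measurable_comb.
have meta : measurable_fun setT (translation_noise v : 'M[R]_(r, d) -> 'cV[R]_d).
  apply: measurable_fun_matrixP => b j.
  have -> : (fun M : 'M[R]_(r, d) => translation_noise v M b j) =
      (fun M => v / r%:R * \sum_a M a b).
    apply/funext => M; rewrite !mxE; congr (_ * _).
    by apply: eq_bigr => a _; rewrite !mxE mulr1.
  apply: measurable_funM => //; apply: measurable_sum => a.
  exact: measurable_entry.
have Zlaw i : gaussian_vector P (Z i) 0 (v ^+ 2 / r%:R)%:M.
  by rewrite -s2 -(sum_selection_sqr s i) ZF; exact: comb_gaussian.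
have ZQ i : independent P (Z i) Q.
  by rewrite ZF; exact: (independent_comp (mcomb i) (@measurable_id _ _ setT) G'Qi).
split.
- by move=> i; rewrite -s2 -(sum_selection_sqr s i) etaF; exact: comb_gaussian.
- pose combs (g : {ffun 'I_p * 'I_d -> R}) :=
    joint (fun i g => comb (selection s i) g) g.
  have mcombs : measurable_fun setT combs by exact: joint_measurable.
  have -> : joint eta = combs \o G.
    by apply/funext => w; apply: eq_from_tnth => i; rewrite !tnth_mktuple etaE.
  exact: (independent_comp mcombs (@measurable_id _ _ setT) GQ).
- apply: independent_cond_mutually_independent => //.
    by move=> i; rewrite ZF; exact: measurableT_comp.
  move=> E C mE mC.
  pose S : set {ffun 'I_p * 'I_d -> R} :=
    \bigcap_(i in [set: 'I_p]) comb (selection s i) @^-1` E i.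
  have mS : measurable S.
    apply: fin_bigcap_measurable; first exact: finite_finset.
    by move=> i _; exact: preimage_measurable.
  have -> : \bigcap_i Z i @^-1` E i = G' @^-1` S.
    by apply/seteqP; split => w /= Ew i _; have := Ew i I; rewrite /= ZE.
  rewrite G'Q//; congr (_ * _)%E.
  (* With [G'] replaced by [G], the event concerns the [eta i], each a function of its own [W i].
     Mutual independence of the [W i] gives the product, and each factor is then carried back to
     [Z i]. *)
  have -> : G @^-1` S = \bigcap_(i in [set` [set: 'I_p]%SET])
      W i @^-1` (translation_noise v @^-1` E i).
    apply/seteqP; split => w /= Ew i _.
      by have := Ew i I; rewrite /= -etaE.
    by have := Ew i; rewrite /= finset.in_setT -etaE; exact.
  rewrite hWindep => [|i]; last exact: preimage_measurable.
  rewrite (eq_bigl predT) => [|i]; last by rewrite finset.in_setT.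
  apply: eq_bigr => i _.
  have -> : Z i @^-1` E i = G' @^-1` (comb (selection s i) @^-1` E i) by rewrite ZF.
  rewrite G'G; last exact: preimage_measurable.
  by congr (P _); apply/seteqP; split => w /=; rewrite -etaE.
- by move=> i; exact: independent_cond_gaussian.
- move=> i j ij.
  pose alpha k := selection s i k - selection s j k.
  have alpha2 : \sum_k alpha k ^+ 2 = 2 * s ^+ 2 by exact: sum_selectionB_sqr.
  have ZB w : Z i w - Z j w = comb alpha (G' w) by rewrite !ZE combB.
  have -> : (fun w => Z i w - Z j w) = (fun w => comb alpha (G' w)).
    by apply/funext => w; exact: ZB.
  split.
  + by rewrite -mulrA -s2 -alpha2; exact: comb_gaussian.
  + rewrite (_ : (fun w => _) = (fun w => norm2 (comb alpha (G' w)) ^+ 2)); last first.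
      by apply/funext => w; rewrite ZB.
    rewrite (comb_norm2_sqr i0 b0 _ NG') alpha2 s2; congr EFin; ring.
  + move=> zeta /andP[z0 z1].
    (* This value makes the tail [expR (- (t ^+ 2 / 2))] equal to [zeta]. *)
    pose t := Num.sqrt (2 * ln (1 / zeta)).
    have lz : 0 <= ln (1 / zeta).
      by rewrite ln_ge0// div1r invf_ge1// ltW.
    have tz : expR (- (t ^+ 2 / 2)) = zeta.
      rewrite sqr_sqrtr ?mulr_ge0// mulrAC divff// !mul1r.
      by rewrite lnV ?posrE// opprK lnK.
    have := comb_norm2_tail i0 b0 alpha (sqrtr_ge0 (2 * ln (1 / zeta))) NG'.
    (* Since [s >= 0], the scale [sqrt (2 * s ^+ 2)] is [sqrt 2 * s]. *)
    rewrite -/t tz alpha2 sqrtrM// sqrtr_sqr ger0_norm//.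
    rewrite mulrA.
    by under eq_set do rewrite -ZB.
Qed.
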